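(* There exist unique real numbers $A^*, B^*, d^*, D^*, U^*, u^*$ such that the function $g=g_{A^*,B^*}$ has a local minimum at a point $x_1<a$ and a local maximum at a point $x_2>a$ with $$d^*<x_1<D^*<U^*<x_2<u^*,$$ and such that $$\int_{d^*}^{D^*}\bigl[g(x)+k\bigr]\,dx=-K,\qquad \int_{U^*}^{u^*}\bigl[g(x)-\ell\bigr]\,dx=L,$$ $$g(d^* )=-k,\qquad g(D^* )=-k,\qquad g(U^* )=\ell,\qquad g(u^* )=\ell .$$ Furthermore, the function $g$ is strictly decreasing on $(-\infty,x_1)$, strictly increasing on $(x_1,x_2)$, and strictly decreasing on $(x_2,\infty)$.
   Context: Fix constants $\mu\in\mathbb{R}$, $\sigma>0$, $\beta>0$, $K>0$, $L>0$, $k>0$, $\ell>0$, and put $\lambda_1=\bigl[(\mu^2+2\beta\sigma^2)^{1/2}-\mu\bigr]/\sigma^2>0$, $\lambda_2=\bigl[(\mu^2+2\beta\sigma^2)^{1/2}+\mu\bigr]/\sigma^2>0$. Assumption on $h:\mathbb{R}\to[0,\infty)$: (a) $h$ is continuous and convex; (b) there is a point $a\in\mathbb{R}$ such that $h$ is $C^2$ on $\mathbb{R}\setminus\{a\}$ and $h(a)=0$; (c) $h'(x)\le 0$ for $x<a$ and $h'(x)\ge 0$ for $x>a$; (d) $\lim_{x\uparrow\infty}h'(x)>\ell\beta$ and $\lim_{x\downarrow-\infty}h'(x)<-k\beta$; (e) $\lim_{x\uparrow\infty}h''(x)/e^{\lambda_1x}=0$ and $\int_a^{\infty}e^{-\lambda_1y}h''(y)\,dy<\infty$;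 (f) $\lim_{x\downarrow-\infty}h''(x)/e^{-\lambda_2x}=0$ and $\int_{-\infty}^ae^{\lambda_2y}h''(y)\,dy<\infty$. For $A,B\in\mathbb{R}$ define $g_{A,B}:\mathbb{R}\to\mathbb{R}$ by $$g_{A,B}(x)=\frac{2}{\sigma^2}\frac{1}{\lambda_1+\lambda_2}\Bigl[\frac{1}{\lambda_1}\Bigl(A-\lambda_1\int_a^xe^{-\lambda_1(y-a)}h'(y)\,dy\Bigr)e^{\lambda_1(x-a)}+\frac{1}{\lambda_2}\Bigl(B+\lambda_2\int_a^xe^{\lambda_2(y-a)}h'(y)\,dy\Bigr)e^{-\lambda_2(x-a)}\Bigr].$$ *)

(* Defs.v *)
From Stdlib Require Import Reals.
From Coquelicot Require Import Coquelicot.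
Open Scope R_scope.

Definition lambda1 (mu sigma beta : R) : R :=
  (sqrt (mu ^ 2 + 2 * beta * sigma ^ 2) - mu) / sigma ^ 2.

Definition lambda2 (mu sigma beta : R) : R :=
  (sqrt (mu ^ 2 + 2 * beta * sigma ^ 2) + mu) / sigma ^ 2.

Definition convex_fun (f : R -> R) : Prop :=
  forall x y t : R, 0 <= t <= 1 ->
    f (t * x + (1 - t) * y) <= t * f x + (1 - t) * f y.

(* The limits of h' are taken in the extended reals: they may be infinite
   (e.g. for quadratic h).  h'' need not be bounded near a, so the integrals
   of h'' are improper at a as well as at infinity; since h'' >= 0 by
   convexity, convergence of the improper integral is its finiteness. *)
Record cost_assumption (mu sigma beta k l a : R) (h : R -> R) : Prop := {
  cost_nonneg : forall x, 0 <= h x;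
  cost_continuous : forall x, continuous h x;
  cost_convex : convex_fun h;
  cost_C2 : forall x, x <> a ->
    ex_derive h x /\ ex_derive (Derive h) x /\ continuous (Derive_n h 2) x;
  cost_at_a : h a = 0;
  cost_deriv_left : forall x, x < a -> Derive h x <= 0;
  cost_deriv_right : forall x, a < x -> 0 <= Derive h x;
  cost_lim_right : exists v : Rbar,
    is_lim (Derive h) p_infty v /\ Rbar_lt (Finite (l * beta)) v;
  cost_lim_left : exists v : Rbar,
    is_lim (Derive h) m_infty v /\ Rbar_lt v (Finite (- k * beta));
  cost_growth_right :
    is_lim (fun x => Derive_n h 2 x / exp (lambda1 mu sigma beta * x))
      p_infty (Finite 0);
  cost_integral_right :
    ex_RInt_gen (fun y => exp (- lambda1 mu sigma beta * y) * Derive_n h 2 y)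
      (at_right a) (Rbar_locally p_infty);
  cost_growth_left :
    is_lim (fun x => Derive_n h 2 x / exp (- lambda2 mu sigma beta * x))
      m_infty (Finite 0);
  cost_integral_left :
    ex_RInt_gen (fun y => exp (lambda2 mu sigma beta * y) * Derive_n h 2 y)
      (Rbar_locally m_infty) (at_left a)
}.

(* [Derive h a] is unspecified when h has a kink at a; this single value does
   not affect the integrals.  [RInt a x] is oriented, so x < a is covered. *)
Definition g_fun (mu sigma beta a : R) (h : R -> R) (A B x : R) : R :=
  let l1 := lambda1 mu sigma beta in
  let l2 := lambda2 mu sigma beta in
  2 / sigma ^ 2 * (1 / (l1 + l2)) *
  (1 / l1 * (A - l1 * RInt (fun y => exp (- l1 * (y - a)) * Derive h y) a x)
     * exp (l1 * (x - a))
   + 1 / l2 * (B + l2 * RInt (fun y => exp (l2 * (y - a)) * Derive h y) a x)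
     * exp (- l2 * (x - a))).

Definition local_min (f : R -> R) (x : R) : Prop :=
  locally x (fun y => f x <= f y).

Definition local_max (f : R -> R) (x : R) : Prop :=
  locally x (fun y => f y <= f x).

Definition strictly_increasing_on (P : R -> Prop) (f : R -> R) : Prop :=
  forall x y, P x -> P y -> x < y -> f x < f y.

Definition strictly_decreasing_on (P : R -> Prop) (f : R -> R) : Prop :=
  forall x y, P x -> P y -> x < y -> f y < f x.

Definition band_conditions (K L k l a : R) (g : R -> R)
    (d D U u x1 x2 : R) : Prop :=
  (x1 < a /\ local_min g x1) /\
  (a < x2 /\ local_max g x2) /\
  (d < x1 /\ x1 < D /\ D < U /\ U < x2 /\ x2 < u) /\
  RInt (fun x => g x + k) d D = - K /\
  RInt (fun x => g x - l) U u = L /\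
  g d = - k /\ g D = - k /\ g U = l /\ g u = l.

(* Main.v *)
Require Import Defs.
From Stdlib Require Import Reals Lra Lia Classical IndefiniteDescription FunctionalExtensionality.
From Coquelicot Require Import Coquelicot.
Open Scope R_scope.

(* Write g = g_{A,B}, P = A - l1 int_a^x e^{-l1 (y-a)} h', Q = B + l2 int_a^x e^{l2 (y-a)} h'
   and E = e^{(l1+l2)(x-a)}.  The derivative g' has the sign of S = P E - Q, and S is
   concave as a function of E because h' is nondecreasing.  Hence S is positive
   between its two zeros and negative outside them, which is the shape of g; the sign of the
   supergradient of S at its zeros puts a negative minimum of g to the left of a and a
   positive maximum to the right.
   Uniqueness: the difference of two solutions is c1 (A - A') e^{l1 (x-a)}
   + c2 (B - B') e^{-l2 (x-a)}.  If both coefficients have the same sign, one g lies above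
   the other and the areas below -k differ; if the signs are opposite, the difference is
   monotone, so it has a constant sign on the well [d, D] or on the hump [U, u], and the
   corresponding areas differ.
   Existence: consider the pairs (A, B) for which the well area is at least K and the hump
   area at least L.  They satisfy B <= A since S(a) = A - B > 0, and with two pairs the
   set contains the pair formed by the smaller A and the larger B, so (inf A, sup B) is
   in the closure; by compactness it is in the set, and by extremality both areas are
   exact. *)

(* Coquelicot's integrals leave equations typed in the carrier of a module
   structure, which [ring] does not recognize as [R]. *)
Ltac real_eq := match goal with |- @eq _ ?x ?y => change (@eq R x y) end.

(** The two area equations are coupled: lowering A deepens the well but lowers the hump, while
    raising B lifts the hump but fills the well. Relaxing both to inequalities avoids solving one
    equation with the other coefficient frozen: extremality yields both at once. The relaxed problem
    must be anchored at a. For A < [Abar] and B > [- Bbar], g tends to minus infinity on the right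
    and to plus infinity on the left, so arbitrarily large areas below -k or above l sit in the
    wrong tail; a well is therefore required to start in (-oo, a] and a hump to end in [a, oo). The
    two thresholds are finite because the weighted integrals of h'' converge. A starting pair is
    found near ([Abar], [- Bbar]): if h' >= v far to the right, g is there almost at least v / beta,
    and symmetrically on the left, which is where the bounds on the limits of h' enter. Since h' may
    jump at a and h'' may blow up there, the estimates rest on inequalities obtained by integrating
    the monotonicity of h'. The reflection of x into -x exchanges wells and humps and halves the
    tail estimates. *)

(** * Integrals and elementary calculus on the real line *)

Lemma continuous_ex_RInt (g : R -> R) (x y : R) :
  (forall z, continuous g z) -> ex_RInt g x y.
Proof. intros Hg. apply (ex_RInt_continuous (V := R_CompleteNormedModule)). auto. Qed.

Lemma continuous_RInt_split (g : R -> R) (x y z : R) :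
  (forall t, continuous g t) -> RInt g x y + RInt g y z = RInt g x z.
Proof.
  intros Hg. apply (RInt_Chasles (V := R_CompleteNormedModule));
    now apply continuous_ex_RInt.
Qed.

Lemma continuous_primitive (g : R -> R) (x y : R) :
  (forall t, continuous g t) -> continuous (fun z => RInt g x z) y.
Proof.
  intros Hg. apply (ex_derive_continuous (V := R_NormedModule)).
  exists (g y). apply (is_derive_RInt g (fun z => RInt g x z) x); auto.
  exists (mkposreal 1 Rlt_0_1); intros z _.
  apply (RInt_correct (V := R_CompleteNormedModule)).
  now apply continuous_ex_RInt.
Qed.

Lemma exp_affine_continuous (s a x : R) : continuous (fun y => exp (s * (y - a))) x.
Proof. apply (ex_derive_continuous (V := R_NormedModule)). auto_derive; auto. Qed.

Lemma RInt_nonpos (g : R -> R) (x y : R) :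
  (forall t, continuous g t) -> x <= y -> (forall t, x <= t <= y -> g t <= 0) ->
  RInt g x y <= 0.
Proof.
  intros Hg Hxy H.
  assert (E : RInt (fun _ : R => 0) x y = 0).
  { rewrite RInt_const. unfold scal; simpl; unfold mult; simpl. ring. }
  rewrite <- E. apply RInt_le; auto.
  - now apply continuous_ex_RInt.
  - apply ex_RInt_const.
  - intros t Ht. apply H; lra.
Qed.

Lemma RInt_shrink (g : R -> R) (d1 D1 d2 D2 : R) :
  (forall x, continuous g x) -> d1 <= d2 -> d2 <= D2 -> D2 <= D1 ->
  (forall x, d1 <= x <= D1 -> g x <= 0) ->
  RInt g d1 D1 <= RInt g d2 D2.
Proof.
  intros Hg H1 H2 H3 Hneg.
  rewrite <- (continuous_RInt_split g d1 d2 D1 Hg).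
  rewrite <- (continuous_RInt_split g d2 D2 D1 Hg).
  assert (RInt g d1 d2 <= 0) by (apply RInt_nonpos; auto; intros; apply Hneg; lra).
  assert (RInt g D2 D1 <= 0) by (apply RInt_nonpos; auto; intros; apply Hneg; lra).
  lra.
Qed.

Lemma RInt_shrink_lt (g1 g2 : R -> R) (d1 D1 d2 D2 : R) :
  (forall x, continuous g1 x) -> (forall x, continuous g2 x) ->
  d1 <= d2 -> d2 < D2 -> D2 <= D1 ->
  (forall x, d1 <= x <= D1 -> g1 x <= 0) ->
  (forall x, d2 < x < D2 -> g1 x < g2 x) ->
  RInt g1 d1 D1 < RInt g2 d2 D2.
Proof.
  intros Hg1 Hg2 H1 H2 H3 Hneg Hlt.
  apply Rle_lt_trans with (RInt g1 d2 D2).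
  - apply RInt_shrink; auto; lra.
  - apply RInt_lt; auto.
Qed.

Lemma continuous_continuity_pt (f : R -> R) (x : R) :
  continuous f x -> continuity_pt f x.
Proof. intros H. now apply continuity_pt_filterlim. Qed.

Lemma continuous_IVT (g : R -> R) (x y v : R) :
  (forall t, continuous g t) -> x <= y ->
  (g x <= v <= g y \/ g y <= v <= g x) -> exists z, x <= z <= y /\ g z = v.
Proof.
  intros Hg Hxy Hv.
  destruct (IVT_gen g x y v) as [z [Hz Ez]].
  - intros t. now apply continuous_continuity_pt.
  - unfold Rmin, Rmax; destruct (Rle_dec (g x) (g y)); lra.
  - exists z. rewrite Rmin_left, Rmax_right in Hz by lra. auto.
Qed.

Lemma continuous_locally_lt (g : R -> R) (x v : R) :
  continuous g x -> g x < v -> locally x (fun y => g y < v).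
Proof. intros Hg Hlt. apply (Hg (fun z => z < v)). now apply (open_lt v). Qed.

Lemma locally_open_interval (x y z : R) (P : R -> Prop) :
  x < y < z -> (forall t, x < t < z -> P t) -> locally y P.
Proof.
  intros H HP.
  assert (Hp : 0 < Rmin (y - x) (z - y)) by (apply Rmin_glb_lt; lra).
  exists (mkposreal _ Hp). intros t Ht.
  unfold ball in Ht; simpl in Ht; unfold AbsRing_ball, abs, minus, plus, opp in Ht;
    simpl in Ht.
  apply Rabs_def2 in Ht.
  pose proof (Rmin_l (y - x) (z - y)). pose proof (Rmin_r (y - x) (z - y)).
  apply HP; lra.
Qed.

Lemma local_min_derive (g : R -> R) (x v : R) :
  local_min g x -> is_derive g x v -> v = 0.
Proof.
  intros [eps H] Hd.
  assert (Hd' : derivable_pt_lim g x v) by now apply is_derive_Reals.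
  set (pr := exist _ v Hd' : derivable_pt g x).
  change v with (derive_pt g x pr).
  pose proof (cond_pos eps).
  apply (deriv_minimum g (x - eps) (x + eps)); try lra.
  intros t H1 H2. apply H.
  unfold ball; simpl; unfold AbsRing_ball, abs, minus, plus, opp; simpl.
  apply Rabs_def1; lra.
Qed.

Lemma local_max_derive (g : R -> R) (x v : R) :
  local_max g x -> is_derive g x v -> v = 0.
Proof.
  intros H Hd.
  assert (- v = 0); [|lra].
  apply (local_min_derive (fun y => - g y) x).
  - destruct H as [eps H]. exists eps. intros y Hy. specialize (H y Hy). lra.
  - apply (is_derive_opp g x v Hd).
Qed.

(** The mean value theorem asks for differentiability only strictly between [a] and [a + r], so each
    difference quotient at [a] is a nearby value of [dg]. Serves to differentiate [profile] at the
    kink of the cost. *)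
Lemma is_derive_removable (g dg : R -> R) (a : R) :
  (forall x, continuous g x) -> (forall x, x <> a -> is_derive g x (dg x)) ->
  continuous dg a -> is_derive g a (dg a).
Proof.
  intros Hg Hd Hc. apply is_derive_Reals. intros eps Heps.
  destruct (Hc (fun z => Rabs (z - dg a) < eps)) as [del Hdel].
  { exists (mkposreal eps Heps). intros z Hz. exact Hz. }
  exists del. intros r Hr Hrd.
  destruct (MVT_gen g a (a + r) dg) as [z [Hz Ez]].
  - intros x Hx. apply Hd. unfold Rmin, Rmax in Hx.
    destruct (Rle_dec a (a + r)); lra.
  - intros x _. now apply continuous_continuity_pt.
  - rewrite Ez. replace (dg z * (a + r - a) / r) with (dg z) by (field; auto).
    apply (Hdel z).
    unfold ball; simpl; unfold AbsRing_ball, abs, minus, plus, opp; simpl.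
    apply Rabs_def2 in Hrd. unfold Rmin, Rmax in Hz.
    apply Rabs_def1; destruct (Rle_dec a (a + r)); lra.
Qed.

Lemma RInt_le_shift (g1 g2 : R -> R) (d D e : R) :
  (forall x, continuous g1 x) -> (forall x, continuous g2 x) -> d <= D ->
  (forall x, d <= x <= D -> g1 x <= g2 x + e) ->
  RInt g1 d D <= RInt g2 d D + e * (D - d).
Proof.
  intros C1 C2 HdD H.
  assert (X := RInt_plus (V := R_CompleteNormedModule) g2 (fun _ => e) d D
                 (continuous_ex_RInt _ _ _ C2) (ex_RInt_const _ _ _)).
  rewrite RInt_const in X.
  unfold plus, scal in X; simpl in X; unfold mult in X; simpl in X.
  rewrite (Rmult_comm e), <- X.
  apply RInt_le; auto.
  - now apply continuous_ex_RInt.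
  - apply continuous_ex_RInt. intros z.
    apply (continuous_plus g2 (fun _ => e)); auto. apply continuous_const.
  - intros x Hx. apply H; lra.
Qed.

(** * Wells, their perturbations and their limits *)

(** A relaxed form of the area conditions: an inequality for the area and no prescribed values at
    the endpoints, so that wells survive limits and the lowering of [g]. Humps are encoded as wells
    of [above]. *)
Definition well (K : R) (g : R -> R) (d D : R) : Prop :=
  d <= D /\ (forall x, d <= x <= D -> g x <= 0) /\ RInt g d D <= - K.

Lemma well_negative_point (K : R) (g : R -> R) (d D : R) :
  0 < K -> (forall x, continuous g x) -> well K g d D ->
  exists x, d <= x <= D /\ g x < 0.
Proof.
  intros HK Hg Hw.
  destruct (continuity_ab_min g d D) as [x [H1 H2]].
  - apply Hw.
  - intros; now apply continuous_continuity_pt.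
  - exists x; split; auto.
    destruct (Rlt_le_dec (g x) 0) as [|Hx]; auto.
    destruct Hw as (W1 & _ & W3).
    assert (0 <= RInt g d D).
    { apply RInt_ge_0; auto. now apply continuous_ex_RInt.
      intros t Ht. apply Rle_trans with (g x); auto. apply H1; lra. }
    lra.
Qed.

Lemma well_le (K : R) (g1 g2 : R -> R) (d D : R) :
  (forall x, continuous g1 x) -> (forall x, continuous g2 x) ->
  (forall x, d <= x <= D -> g2 x <= g1 x) -> well K g1 d D -> well K g2 d D.
Proof.
  intros C1 C2 Hle (H1 & H2 & H3). split; [auto|split].
  - intros x Hx. specialize (H2 x Hx). specialize (Hle x Hx). lra.
  - apply Rle_trans with (RInt g1 d D); auto.
    apply RInt_le; auto; try now apply continuous_ex_RInt.
    intros; apply Hle; lra.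
Qed.

(** In use [g] vanishes at [d] and [D], so raising it spoils the sign there and the endpoints must
    move inwards. The spare area [s] is spent in thirds: one at each end, one on the upward shift by
    [eps]. [eta] lets the caller keep an endpoint on its side of the kink. *)
Lemma well_robust (K eta : R) (g : R -> R) (d D : R) :
  (forall x, continuous g x) -> 0 < eta -> d < D ->
  (forall x, d < x < D -> g x < 0) -> RInt g d D < - K ->
  exists eps d' D', 0 < eps /\ d < d' < d + eta /\ D - eta < D' < D /\
    forall g2, (forall x, continuous g2 x) ->
      (forall x, d' <= x <= D' -> g2 x <= g x + eps) -> well K g2 d' D'.
Proof.
  intros Hg Heta HdD Hneg Harea.
  set (s := - K - RInt g d D). assert (Hs : 0 < s) by (unfold s; lra).
  assert (Hs3 : 0 < s / 3) by lra.
  assert (C1 := continuous_primitive g d d Hg).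
  assert (C2 := continuous_primitive g D D Hg).
  destruct (C1 (fun z => Rabs (z - RInt g d d) < s / 3)) as [e1 He1].
  { exists (mkposreal _ Hs3). intros z Hz. exact Hz. }
  destruct (C2 (fun z => Rabs (z - RInt g D D) < s / 3)) as [e2 He2].
  { exists (mkposreal _ Hs3). intros z Hz. exact Hz. }
  rewrite (RInt_point (V := R_CompleteNormedModule)) in He1, He2.
  change zero with 0 in He1, He2.
  set (del := Rmin (Rmin e1 e2) (Rmin eta ((D - d) / 2)) / 2).
  assert (Hdel : 0 < del /\ del < e1 /\ del < e2 /\ del < eta /\ del < (D - d) / 2).
  { unfold del.
    pose proof (cond_pos e1). pose proof (cond_pos e2).
    pose proof (Rmin_l e1 e2). pose proof (Rmin_r e1 e2).
    pose proof (Rmin_l eta ((D - d) / 2)). pose proof (Rmin_r eta ((D - d) / 2)).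
    pose proof (Rmin_l (Rmin e1 e2) (Rmin eta ((D - d) / 2))).
    pose proof (Rmin_r (Rmin e1 e2) (Rmin eta ((D - d) / 2))).
    assert (0 < Rmin (Rmin e1 e2) (Rmin eta ((D - d) / 2)))
      by (repeat apply Rmin_glb_lt; lra).
    lra. }
  destruct Hdel as (P0 & P1 & P2 & P3 & P4).
  assert (B1 : Rabs (RInt g d (d + del) - 0) < s / 3).
  { apply He1. unfold ball; simpl; unfold AbsRing_ball, abs, minus, plus, opp; simpl.
    apply Rabs_def1; lra. }
  assert (B2 : Rabs (RInt g D (D - del) - 0) < s / 3).
  { apply He2. unfold ball; simpl; unfold AbsRing_ball, abs, minus, plus, opp; simpl.
    apply Rabs_def1; lra. }
  apply Rabs_def2 in B1. apply Rabs_def2 in B2.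
  assert (Esum : RInt g (d + del) (D - del)
                 = RInt g d D - RInt g d (d + del) + RInt g D (D - del)).
  { pose proof (continuous_RInt_split g d (d + del) (D - del) Hg).
    pose proof (continuous_RInt_split g d D (D - del) Hg). lra. }
  (* On the shrunken closed interval the maximum of [g] is attained, hence negative; this is the
     room for [eps]. *)
  destruct (continuity_ab_maj g (d + del) (D - del)) as [m [Hm1 Hm2]]; [lra| |].
  { intros; now apply continuous_continuity_pt. }
  assert (Hm : g m < 0) by (apply Hneg; lra).
  assert (Hs' : 0 < s / 3 / (D - d)) by (apply Rdiv_lt_0_compat; lra).
  set (eps := Rmin (- g m) (s / 3 / (D - d))).
  assert (Heps : 0 < eps) by (apply Rmin_glb_lt; lra).
  assert (Ee1 : eps <= - g m) by apply Rmin_l.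
  assert (Ee2 : eps <= s / 3 / (D - d)) by apply Rmin_r.
  exists eps, (d + del), (D - del).
  repeat split; try lra.
  - intros x Hx. specialize (H0 x Hx). specialize (Hm1 x Hx). lra.
  - assert (X : RInt g2 (d + del) (D - del)
                <= RInt g (d + del) (D - del) + eps * (D - del - (d + del)))
      by (apply RInt_le_shift; auto; lra).
    assert (eps * (D - del - (d + del)) <= s / 3).
    { apply Rle_trans with (s / 3 / (D - d) * (D - d)).
      - apply Rmult_le_compat; lra.
      - right; field; lra. }
    unfold s in *; lra.
Qed.

Lemma bounded_subsequence (u : nat -> R) (m M : R) :
  (forall n, m <= u n <= M) ->
  exists (phi : nat -> nat) (x : R), m <= x <= M /\
    filterlim phi eventually eventually /\ is_lim_seq (fun n => u (phi n)) x.
Proof.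
  intros Hu.
  destruct (Bolzano_Weierstrass u _ (compact_P3 m M) Hu) as [x Hx].
  assert (Hex : forall n : nat, exists p, (n <= p)%nat /\ Rabs (u p - x) < / INR (S n)).
  { intros n.
    assert (Hp : 0 < / INR (S n)) by (apply Rinv_0_lt_compat, lt_0_INR; lia).
    destruct (Hx (fun y => Rabs (y - x) < / INR (S n)) n) as [p Hp'].
    - exists (mkposreal _ Hp). intros y Hy. exact Hy.
    - exists p. auto. }
  apply functional_choice in Hex. destruct Hex as [phi Hphi].
  assert (Hlim : is_lim_seq (fun n => u (phi n)) x).
  { apply is_lim_seq_spec. intros eps.
    destruct (archimed_cor1 eps (cond_pos eps)) as [N [HN HN0]].
    exists N. intros n Hn. destruct (Hphi n) as [_ H].
    apply Rlt_trans with (/ INR (S n)); auto.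
    apply Rle_lt_trans with (/ INR N); auto.
    apply Rinv_le_contravar. apply lt_0_INR; lia. apply le_INR; lia. }
  exists phi, x. split; [|split]; auto.
  - split.
    + apply (is_lim_seq_le (fun _ => m) (fun n => u (phi n)) m x); auto.
      intros; apply Hu. apply is_lim_seq_const.
    + apply (is_lim_seq_le (fun n => u (phi n)) (fun _ => M) x M); auto.
      intros; apply Hu. apply is_lim_seq_const.
  - intros P [N HN]. exists N. intros n Hn. apply HN.
    destruct (Hphi n); lia.
Qed.

(** The endpoints of ever better approximate wells stay in compact intervals, so a subsequence
    converges. Separate ranges for [d] and [D] preserve in the limit the side of the kink on which
    an endpoint lies. *)
Lemma well_closed (K m1 M1 m2 M2 : R) (g : R -> R) :
  0 < K -> (forall x, continuous g x) ->
  (forall eps, 0 < eps -> exists d D, m1 <= d <= M1 /\ m2 <= D <= M2 /\ d <= D /\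
     (forall x, d <= x <= D -> g x <= eps) /\ RInt g d D <= - K + eps) ->
  exists d D, m1 <= d <= M1 /\ m2 <= D <= M2 /\ well K g d D.
Proof.
  intros HK Hg H.
  assert (Hpos : forall n : nat, 0 < / INR (S n))
    by (intros; apply Rinv_0_lt_compat, lt_0_INR; lia).
  assert (Hinv : is_lim_seq (fun n => / INR (S n)) 0).
  { apply (is_lim_seq_incr_1 (fun n => / INR n)).
    apply (is_lim_seq_inv INR p_infty); [apply is_lim_seq_INR | discriminate]. }
  assert (H' := fun n => H _ (Hpos n)). clear H.
  apply functional_choice in H'. destruct H' as [d H].
  apply functional_choice in H. destruct H as [D H].
  destruct (bounded_subsequence d m1 M1) as (phi & x & Hx & Fphi & Lx);
    [intros; apply H|].
  destruct (bounded_subsequence (fun n => D (phi n)) m2 M2) as (psi & y & Hy & Fpsi & Ly);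
    [intros; apply H|].
  set (th := fun n => phi (psi n)).
  assert (Fth : filterlim th eventually eventually).
  { exact (filterlim_comp _ _ _ psi phi _ _ _ Fpsi Fphi). }
  assert (Lx' : is_lim_seq (fun n => d (th n)) x).
  { exact (is_lim_seq_subseq (fun n => d (phi n)) x psi Fpsi Lx). }
  assert (Ly' : is_lim_seq (fun n => D (th n)) y) by exact Ly.
  assert (Linv : is_lim_seq (fun n => / INR (S (th n))) 0).
  { exact (is_lim_seq_subseq _ 0 th Fth Hinv). }
  assert (Hxy : x <= y).
  { apply (is_lim_seq_le (fun n => d (th n)) (fun n => D (th n)) x y); auto.
    intros; apply H. }
  assert (Harea : RInt g x y <= - K).
  { apply (is_lim_seq_le (fun n => RInt g 0 (D (th n)) - RInt g 0 (d (th n)))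
             (fun n => - K + / INR (S (th n))) (RInt g x y) (- K)).
    - intros n. destruct (H (th n)) as (_ & _ & _ & _ & Hn).
      pose proof (continuous_RInt_split g 0 (d (th n)) (D (th n)) Hg). lra.
    - replace (RInt g x y) with (RInt g 0 y - RInt g 0 x)
        by (pose proof (continuous_RInt_split g 0 x y Hg); lra).
      apply is_lim_seq_minus';
        apply (is_lim_seq_continuous (fun z => RInt g 0 z)); auto;
        apply continuous_continuity_pt; now apply continuous_primitive.
    - replace (Finite (- K)) with (Finite (- K + 0)) by (f_equal; ring).
      apply is_lim_seq_plus'; auto. apply is_lim_seq_const. }
  exists x, y. split; [auto|split; [auto|split; [auto|split; [|auto]]]].
  (* The approximate endpoints may converge from inside [[x, y]], so the sign is obtained first at
     interior points and only then, by continuity, at [x] and [y]. *)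
  assert (Hin : forall z, x < z < y -> g z <= 0).
  { intros z Hz.
    apply is_lim_seq_spec in Lx'. apply is_lim_seq_spec in Ly'.
    apply is_lim_seq_spec in Linv.
    apply Rnot_lt_le. intros Hgz.
    assert (Px : 0 < z - x) by lra. assert (Py : 0 < y - z) by lra.
    destruct (Lx' (mkposreal _ Px)) as [N1 HN1].
    destruct (Ly' (mkposreal _ Py)) as [N2 HN2].
    destruct (Linv (mkposreal _ Hgz)) as [N3 HN3].
    set (N := (N1 + N2 + N3)%nat).
    specialize (HN1 N ltac:(unfold N; lia)).
    specialize (HN2 N ltac:(unfold N; lia)).
    specialize (HN3 N ltac:(unfold N; lia)). simpl in HN1, HN2, HN3.
    apply Rabs_def2 in HN1. apply Rabs_def2 in HN2. apply Rabs_def2 in HN3.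
    destruct (H (th N)) as (_ & _ & _ & Hn & _).
    specialize (Hn z ltac:(lra)).
    change (match th N with | O => 1 | S _ => INR (th N) + 1 end)
      with (INR (S (th N))) in HN3. lra. }
  assert (Hlt : x < y).
  { destruct Hxy as [|E]; auto. rewrite E, (RInt_point (V := R_CompleteNormedModule)) in Harea.
    change (0 <= - K) in Harea. lra. }
  intros z Hz. apply Rnot_lt_le. intros Hgz.
  destruct (continuous_locally_lt (fun t => - g t) z 0) as [e He].
  { apply (continuous_opp g). auto. }
  { lra. }
  (* [w] is [z] pushed towards the middle: strictly inside [[x, y]], yet close enough to [z] for [g]
     to be still positive. *)
  set (w := if Rle_dec z ((x + y) / 2) then z + Rmin (e / 2) ((y - x) / 4)
            else z - Rmin (e / 2) ((y - x) / 4)).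
  pose proof (cond_pos e).
  assert (0 < Rmin (e / 2) ((y - x) / 4)) by (apply Rmin_glb_lt; lra).
  pose proof (Rmin_l (e / 2) ((y - x) / 4)). pose proof (Rmin_r (e / 2) ((y - x) / 4)).
  assert (Hw : x < w < y /\ z - e < w < z + e).
  { unfold w. destruct (Rle_dec z ((x + y) / 2)); lra. }
  assert (- g w < 0).
  { apply He. unfold ball; simpl; unfold AbsRing_ball, abs, minus, plus, opp; simpl.
    apply Rabs_def1; lra. }
  specialize (Hin w ltac:(lra)). lra.
Qed.

Lemma well_limit (K m1 M1 m2 M2 : R) (g : R -> R) :
  0 < K -> (forall x, continuous g x) ->
  (forall eps, 0 < eps -> exists (g2 : R -> R) (d D : R),
     (forall x, continuous g2 x) /\ m1 <= d <= M1 /\ m2 <= D <= M2 /\ well K g2 d D /\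
     forall x, d <= x <= D -> g x <= g2 x + eps) ->
  exists d D, m1 <= d <= M1 /\ m2 <= D <= M2 /\ well K g d D.
Proof.
  intros HK Hg H. apply well_closed; auto. intros eps Heps.
  (* [W] is at least 1 and at least the length of every candidate interval, so an error [eps / W]
     costs at most [eps] both pointwise and in area. *)
  set (W := 1 + Rabs (M2 - m1)).
  assert (HW : 1 <= W) by (unfold W; pose proof (Rabs_pos (M2 - m1)); lra).
  assert (HW' : M2 - m1 <= W) by (unfold W; pose proof (Rle_abs (M2 - m1)); lra).
  assert (Heps' : 0 < eps / W) by (apply Rdiv_lt_0_compat; lra).
  assert (E : eps / W * W = eps) by (field; lra).
  destruct (H _ Heps') as (g2 & d & D & Hg2 & Hd & HD & (W1 & W2 & W3) & Hle).
  exists d, D. split; [auto|split; [auto|split; [auto|split]]].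
  - intros x Hx. specialize (Hle x Hx). specialize (W2 x Hx). nra.
  - apply Rle_trans with (RInt g2 d D + eps / W * (D - d)).
    + now apply RInt_le_shift.
    + assert (eps / W * (D - d) <= eps / W * W) by (apply Rmult_le_compat_l; lra). lra.
Qed.

(** * The profile of [g] and its slope *)

Lemma exp_decay (l C eps : R) :
  0 < l -> 0 < eps -> exists T, 0 <= T /\ forall t, T <= t -> C * exp (- l * t) <= eps.
Proof.
  intros Hl Heps. set (T := Rabs C / (eps * l)).
  assert (Hel : 0 < eps * l) by nra.
  assert (HT : 0 <= T)
    by (apply Rmult_le_pos; [apply Rabs_pos | apply Rlt_le, Rinv_0_lt_compat; auto]).
  exists T. split; auto. intros t Ht.
  assert (H1 : C <= eps * (l * t)).
  { apply Rle_trans with (1 := Rle_abs C).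
    replace (Rabs C) with (T * (eps * l)) by (unfold T; field; lra). nra. }
  pose proof (exp_ineq1_le (l * t)).
  replace eps with (eps * exp (l * t) * exp (- l * t)).
  - apply Rmult_le_compat_r; [left; apply exp_pos | nra].
  - rewrite Rmult_assoc, <- exp_plus.
    replace (l * t + - l * t) with 0 by ring. rewrite exp_0. ring.
Qed.

(* [f] is the derivative of the cost, with value 0 at the kink [a];
   [J1 x] is [l1 * int_a^x exp (- l1 (y - a)) f y dy] and [J2 x] is
   [l2 * int_a^x exp (l2 (y - a)) f y dy], with suprema [Abar] over [a, oo) and
   [Bbar] over (-oo, a].  [kernel_J1_le] and [kernel_J2_le] hold for either order of
   the points [x] and [y], and together with the monotonicity of [f] they replace
   the second derivative of the cost. *)
Record kernel (l1 l2 c a : R) (f J1 J2 : R -> R) (Abar Bbar : R) : Prop := {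
  kernel_l1 : 0 < l1;
  kernel_l2 : 0 < l2;
  kernel_c : 0 < c;
  kernel_mono : forall x y, x <= y -> f x <= f y;
  kernel_f_a : f a = 0;
  kernel_J1_a : J1 a = 0;
  kernel_J2_a : J2 a = 0;
  kernel_J1_le : forall x y,
    f x * (exp (- l1 * (x - a)) - exp (- l1 * (y - a))) <= J1 y - J1 x;
  kernel_J2_le : forall x y,
    f x * (exp (l2 * (y - a)) - exp (l2 * (x - a))) <= J2 y - J2 x;
  kernel_J1_derive : forall x, x <> a ->
    is_derive J1 x (l1 * exp (- l1 * (x - a)) * f x);
  kernel_J2_derive : forall x, x <> a ->
    is_derive J2 x (l2 * exp (l2 * (x - a)) * f x);
  kernel_J1_continuous : forall x, continuous J1 x;
  kernel_J2_continuous : forall x, continuous J2 x;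
  kernel_Abar_ub : forall x, a <= x -> J1 x <= Abar;
  kernel_Abar_lub : forall A, A < Abar -> exists x, a <= x /\ A < J1 x;
  kernel_Bbar_ub : forall x, x <= a -> J2 x <= Bbar;
  kernel_Bbar_lub : forall B, B < Bbar -> exists x, x <= a /\ B < J2 x
}.

Definition profile (l1 l2 c a : R) (J1 J2 : R -> R) (A B x : R) : R :=
  c * (1 / l1 * (A - J1 x) * exp (l1 * (x - a))
       + 1 / l2 * (B + J2 x) * exp (- l2 * (x - a))).

(** Reflection swaps the two exponentials and the two tails; together with [profile_reflect] it
    turns each estimate on the right into one on the left, with (A, B) replaced by (-B, -A). *)
Lemma kernel_reflect l1 l2 c a f J1 J2 Abar Bbar :
  kernel l1 l2 c a f J1 J2 Abar Bbar ->
  kernel l2 l1 c (- a) (fun x => - f (- x)) (fun x => J2 (- x)) (fun x => J1 (- x))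
    Bbar Abar.
Proof.
  intros [? ? ? mono fa J1a J2a J1le J2le dJ1 dJ2 cJ1 cJ2 Aub Alub Bub Blub].
  assert (Hopp : forall x, is_derive (fun y => - y) x (- 1)).
  { intros x. auto_derive; auto. }
  assert (Copp : forall x, continuous (fun y : R => - y) x).
  { intros x. apply (continuous_opp (fun y : R => y)). apply continuous_id. }
  split; auto.
  - intros x y Hxy. assert (f (- y) <= f (- x)) by (apply mono; lra). lra.
  - rewrite Ropp_involutive, fa. ring.
  - now rewrite Ropp_involutive.
  - now rewrite Ropp_involutive.
  - intros x y. specialize (J2le (- x) (- y)).
    replace (- l2 * (x - - a)) with (l2 * (- x - a)) by ring.
    replace (- l2 * (y - - a)) with (l2 * (- y - a)) by ring. lra.
  - intros x y. specialize (J1le (- x) (- y)).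
    replace (l1 * (x - - a)) with (- l1 * (- x - a)) by ring.
    replace (l1 * (y - - a)) with (- l1 * (- y - a)) by ring. lra.
  - intros x Hx. assert (Hx' : - x <> a) by lra.
    replace (l2 * exp (- l2 * (x - - a)) * - f (- x))
      with (- 1 * (l2 * exp (l2 * (- x - a)) * f (- x))).
    + apply (is_derive_comp J2 (fun y => - y)); auto.
    + replace (l2 * (- x - a)) with (- l2 * (x - - a)) by ring. ring.
  - intros x Hx. assert (Hx' : - x <> a) by lra.
    replace (l1 * exp (l1 * (x - - a)) * - f (- x))
      with (- 1 * (l1 * exp (- l1 * (- x - a)) * f (- x))).
    + apply (is_derive_comp J1 (fun y => - y)); auto.
    + replace (- l1 * (- x - a)) with (l1 * (x - - a)) by ring. ring.
  - intros x. apply (continuous_comp (fun y : R => - y) J2); auto.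
  - intros x. apply (continuous_comp (fun y : R => - y) J1); auto.
  - intros x Hx. apply Bub. lra.
  - intros A HA. destruct (Blub A HA) as [x [H1' H2']]. exists (- x).
    rewrite Ropp_involutive. split; auto; lra.
  - intros x Hx. apply Aub. lra.
  - intros A HA. destruct (Alub A HA) as [x [H1' H2']]. exists (- x).
    rewrite Ropp_involutive. split; auto; lra.
Qed.

Lemma profile_reflect l1 l2 c a J1 J2 A B x :
  profile l2 l1 c (- a) (fun y => J2 (- y)) (fun y => J1 (- y)) (- B) (- A) (- x)
  = - profile l1 l2 c a J1 J2 A B x.
Proof.
  unfold profile. rewrite Ropp_involutive.
  replace (l2 * (- x - - a)) with (- l2 * (x - a)) by ring.
  replace (- l1 * (- x - - a)) with (l1 * (x - a)) by ring. ring.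
Qed.

(** * The profile far from the kink *)

(** Once [J1] has passed [A], the first term is at most a negative multiple of e^{l1 (x-a)}. The
    second is at most a constant plus a multiple of [f x], and [f x] is of smaller order than e^{l1
    (x-a)} because [J1] is bounded. *)
Lemma profile_right_tail l1 l2 c a f J1 J2 Abar Bbar
  (H : kernel l1 l2 c a f J1 J2 Abar Bbar) A B v :
  A < Abar -> exists M, a <= M /\ forall x, M <= x -> profile l1 l2 c a J1 J2 A B x < v.
Proof.
  intros HA. destruct H.
  destruct (kernel_Abar_lub0 A HA) as [y0 [Hy0 HAy0]].
  set (del := J1 y0 - A). assert (Hdel : 0 < del) by (unfold del; lra).
  (* Chosen so that [eps / l2 = del / (2 * l1)]: the second term then uses up at most half of the
     decay of the first. *)
  set (eps := del * l2 / (2 * l1)).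
  assert (Heps : 0 < eps) by (apply Rdiv_lt_0_compat; nra).
  assert (Hq : 0 < 1 - exp (- l1)).
  { assert (exp (- l1) < exp 0) by (apply exp_increasing; lra).
    rewrite exp_0 in *; lra. }
  destruct (kernel_Abar_lub0 (Abar - eps * (1 - exp (- l1)))) as [y1 [Hy1 HJy1]].
  { assert (0 < eps * (1 - exp (- l1))) by (apply Rmult_lt_0_compat; lra). lra. }
  assert (Hmono : forall x y, a <= x -> x <= y -> J1 x <= J1 y).
  { intros x y Hx Hxy. specialize (kernel_J1_le0 x y).
    assert (0 <= f x) by (rewrite <- kernel_f_a0; auto).
    assert (exp (- l1 * (y - a)) <= exp (- l1 * (x - a))).
    { destruct Hxy as [Hxy|E]; [left; apply exp_increasing; nra | rewrite E; lra]. }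
    nra. }
  destruct (exp_decay l1 (Rabs B / l2 + Rabs v / c + 1) (del / (2 * l1)))
    as [T [HT HTd]]; auto.
  { apply Rdiv_lt_0_compat; lra. }
  exists (Rmax (Rmax y0 y1) (a + T)).
  pose proof (Rmax_l (Rmax y0 y1) (a + T)). pose proof (Rmax_r (Rmax y0 y1) (a + T)).
  pose proof (Rmax_l y0 y1). pose proof (Rmax_r y0 y1).
  split; [lra|]. intros x Hx.
  assert (HP : A - J1 x <= - del).
  { assert (J1 y0 <= J1 x) by (apply Hmono; lra). unfold del; lra. }
  set (e := exp (l1 * (x - a))). set (e' := exp (- l1 * (x - a))).
  assert (Ee : e * e' = 1).
  { unfold e, e'. rewrite <- exp_plus.
    replace (l1 * (x - a) + - l1 * (x - a)) with 0 by ring. apply exp_0. }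
  assert (He : 0 < e) by apply exp_pos. assert (He' : 0 < e') by apply exp_pos.
  (* The increment of [J1] over [[x, x + 1]] is at least [f x * e' * (1 - exp (- l1))], and beyond
     [y1] it is less than [eps * (1 - exp (- l1))], since [J1] stays below [Abar]. *)
  assert (Hf : f x <= eps * e).
  { assert (X := kernel_J1_le0 x (x + 1)).
    replace (- l1 * (x + 1 - a)) with (- l1 * (x - a) + - l1) in X by ring.
    rewrite exp_plus in X. fold e' in X.
    assert (J1 y1 <= J1 x) by (apply Hmono; lra).
    assert (J1 (x + 1) <= Abar) by (apply kernel_Abar_ub0; lra).
    assert (f x * e' * (1 - exp (- l1)) < eps * (1 - exp (- l1))) by nra.
    assert (f x * e' < eps) by nra.
    replace (f x) with (f x * e' * e) by (rewrite Rmult_assoc, (Rmult_comm e'), Ee; ring).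
    apply Rmult_le_compat_r; lra. }
  set (q := exp (l2 * (x - a))). set (q' := exp (- l2 * (x - a))).
  assert (Eq : q * q' = 1).
  { unfold q, q'. rewrite <- exp_plus.
    replace (l2 * (x - a) + - l2 * (x - a)) with 0 by ring. apply exp_0. }
  assert (Hqp : 0 < q) by apply exp_pos.
  assert (Hq' : 0 < q' <= 1).
  { split; [apply exp_pos|]. unfold q'. rewrite <- exp_0.
    destruct (Req_dec (x - a) 0) as [E|E].
    - rewrite E, Rmult_0_r; lra.
    - left; apply exp_increasing; nra. }
  assert (HJ2 : J2 x <= f x * q).
  { assert (X := kernel_J2_le0 x a). rewrite kernel_J2_a0 in X. fold q in X.
    replace (l2 * (a - a)) with 0 in X by ring. rewrite exp_0 in X.
    assert (0 <= f x) by (rewrite <- kernel_f_a0; apply kernel_mono0; lra). lra. }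
  assert (Hu2 : (B + J2 x) * q' <= Rabs B + eps * e).
  { assert (B * q' <= Rabs B).
    { pose proof (Rle_abs B). pose proof (Rabs_pos B). nra. }
    assert (J2 x * q' <= f x).
    { replace (f x) with (f x * q * q') by (rewrite Rmult_assoc, Eq; ring).
      apply Rmult_le_compat_r; lra. }
    lra. }
  assert (Hbig : Rabs B / l2 + Rabs v / c + 1 <= del / (2 * l1) * e).
  { assert (X : (Rabs B / l2 + Rabs v / c + 1) * exp (- l1 * (x - a)) <= del / (2 * l1))
      by (apply HTd; lra). fold e' in X.
    replace (Rabs B / l2 + Rabs v / c + 1)
      with ((Rabs B / l2 + Rabs v / c + 1) * e' * e)
      by (rewrite Rmult_assoc, (Rmult_comm e'), Ee; ring).
    apply Rmult_le_compat_r; lra. }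
  unfold profile. fold e q'.
  assert (T1 : 1 / l1 * (A - J1 x) * e <= - (del / l1) * e).
  { apply Rmult_le_compat_r; [lra|].
    replace (- (del / l1)) with (1 / l1 * - del) by (field; lra).
    apply Rmult_le_compat_l; auto. left; apply Rdiv_lt_0_compat; lra. }
  assert (T2 : 1 / l2 * (B + J2 x) * q' <= Rabs B / l2 + del / (2 * l1) * e).
  { replace (Rabs B / l2 + del / (2 * l1) * e) with (1 / l2 * (Rabs B + eps * e))
      by (unfold eps; field; lra).
    rewrite Rmult_assoc. apply Rmult_le_compat_l; auto.
    left; apply Rdiv_lt_0_compat; lra. }
  assert (T3 : 1 / l1 * (A - J1 x) * e + 1 / l2 * (B + J2 x) * q' <= - (Rabs v / c) - 1).
  { replace (- (del / l1) * e) with (- (2 * (del / (2 * l1) * e))) in T1 by (field; lra).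
    lra. }
  apply Rle_lt_trans with (c * (- (Rabs v / c) - 1)).
  - apply Rmult_le_compat_l; lra.
  - replace (c * (- (Rabs v / c) - 1)) with (- Rabs v - c) by (field; lra).
    assert (- v <= Rabs v) by (rewrite <- Rabs_Ropp; apply Rle_abs). lra.
Qed.

Lemma profile_left_tail l1 l2 c a f J1 J2 Abar Bbar
  (H : kernel l1 l2 c a f J1 J2 Abar Bbar) A B v :
  - Bbar < B -> exists m, m <= a /\ forall x, x <= m -> v < profile l1 l2 c a J1 J2 A B x.
Proof.
  intros HB.
  destruct (profile_right_tail _ _ _ _ _ _ _ _ _ (kernel_reflect _ _ _ _ _ _ _ _ _ H)
              (- B) (- A) (- v)) as [M [HM HMx]]; [lra|].
  exists (- M). split; [lra|]. intros x Hx.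
  specialize (HMx (- x) ltac:(lra)). rewrite profile_reflect in HMx. lra.
Qed.

(** With the coefficients ([Abar], [- Bbar]) and [f >= v], the two terms are at least [c * v / l1]
    and, up to a decaying error, [c * v / l2]; their sum exceeds [l]. The window of length [L / eps]
    carries area [L] at height [eps] above [l]. *)
Lemma profile_right_start l1 l2 c a f J1 J2 Abar Bbar
  (H : kernel l1 l2 c a f J1 J2 Abar Bbar) L l v M0 :
  0 < l -> (forall x, M0 <= x -> v <= f x) -> l < c * (1 / l1 + 1 / l2) * v ->
  exists A M eps, A < Abar /\ a <= M /\ 0 < eps /\
    forall x, M <= x <= M + L / eps -> l + eps <= profile l1 l2 c a J1 J2 A (- Bbar) x.
Proof.
  intros Hl Hv Hlv. destruct H.
  assert (I1 : 0 < 1 / l1) by (apply Rdiv_lt_0_compat; lra).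
  assert (I2 : 0 < 1 / l2) by (apply Rdiv_lt_0_compat; lra).
  assert (Hv0 : 0 < v).
  { apply Rnot_le_lt; intros Hle.
    assert (0 < c * (1 / l1 + 1 / l2)) by (apply Rmult_lt_0_compat; lra). nra. }
  set (m := Rmax M0 a). assert (Hm0 : M0 <= m) by apply Rmax_l.
  assert (Hma : a <= m) by apply Rmax_r.
  assert (Hdec : forall x y, x <= y -> exp (- l1 * (y - a)) <= exp (- l1 * (x - a))).
  { intros x y [Hxy|E]; [left; apply exp_increasing; nra | rewrite E; lra]. }
  assert (Hinc : forall x y, x <= y -> exp (l2 * (x - a)) <= exp (l2 * (y - a))).
  { intros x y [Hxy|E]; [left; apply exp_increasing; nra | rewrite E; lra]. }
  (* The limit of [kernel_J1_le] as [y] tends to infinity, where [J1 y] is bounded by [Abar]; a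
     positive [gap] is refuted at one large [y]. *)
  assert (HP : forall x, m <= x -> v * exp (- l1 * (x - a)) <= Abar - J1 x).
  { intros x Hx. apply Rnot_lt_le. intros Hlt.
    set (gap := v * exp (- l1 * (x - a)) - (Abar - J1 x)).
    assert (Hgap : 0 < gap / 2) by (unfold gap; lra).
    destruct (exp_decay l1 v (gap / 2) ltac:(lra) Hgap) as [T [HT HTd]].
    set (y := Rmax x (a + T)).
    assert (Y1 : x <= y) by apply Rmax_l. assert (Y2 : a + T <= y) by apply Rmax_r.
    specialize (HTd (y - a) ltac:(lra)).
    assert (X := kernel_J1_le0 x y).
    assert (J1 y <= Abar) by (apply kernel_Abar_ub0; lra).
    assert (v <= f x) by (apply Hv; lra).
    specialize (Hdec x y Y1). unfold gap in *. nra. }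
  set (C := Rabs (- Bbar + J2 m - v * exp (l2 * (m - a)))).
  assert (HQ : forall x, m <= x -> v * exp (l2 * (x - a)) - C <= - Bbar + J2 x).
  { intros x Hx. assert (X := kernel_J2_le0 m x).
    assert (v <= f m) by (apply Hv; lra). specialize (Hinc m x Hx).
    assert (- (- Bbar + J2 m - v * exp (l2 * (m - a))) <= C)
      by (unfold C; rewrite <- Rabs_Ropp; apply Rle_abs).
    nra. }
  (* A third of the excess over [l]: one share for the decaying error with [C], one for lowering [A]
     below [Abar], and one left as height. *)
  set (eps := (c * (1 / l1 + 1 / l2) * v - l) / 3).
  assert (Heps : 0 < eps) by (unfold eps; lra).
  destruct (exp_decay l2 (c * (1 / l2) * C) eps ltac:(lra) Heps) as [T [HT HTd]].
  set (M := Rmax m (a + T)).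
  assert (HM1 : m <= M) by apply Rmax_l. assert (HM2 : a + T <= M) by apply Rmax_r.
  (* Lowering [A] by [eta] costs exactly [eps] at the right end of the window, and at most that on
     the rest of it. *)
  set (eta := eps / (c * (1 / l1) * exp (l1 * (M + L / eps - a)))).
  assert (Hden : 0 < c * (1 / l1) * exp (l1 * (M + L / eps - a))).
  { pose proof (exp_pos (l1 * (M + L / eps - a))).
    apply Rmult_lt_0_compat; auto. apply Rmult_lt_0_compat; lra. }
  assert (Heta : 0 < eta) by (apply Rdiv_lt_0_compat; lra).
  assert (Eeta : c * (1 / l1) * exp (l1 * (M + L / eps - a)) * eta = eps)
    by (unfold eta; field; pose proof (exp_pos (l1 * (M + L / eps - a))); repeat split; lra).
  exists (Abar - eta), M, eps. split; [lra|split; [lra|split; [lra|]]].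
  intros x Hx. unfold profile.
  specialize (HP x ltac:(lra)). specialize (HQ x ltac:(lra)).
  specialize (HTd (x - a) ltac:(lra)).
  set (e := exp (l1 * (x - a))) in *. set (e' := exp (- l1 * (x - a))) in *.
  assert (Ee : e' * e = 1).
  { unfold e, e'. rewrite <- exp_plus.
    replace (- l1 * (x - a) + l1 * (x - a)) with 0 by ring. apply exp_0. }
  set (q := exp (l2 * (x - a))) in *. set (q' := exp (- l2 * (x - a))) in *.
  assert (Eq : q * q' = 1).
  { unfold q, q'. rewrite <- exp_plus.
    replace (l2 * (x - a) + - l2 * (x - a)) with 0 by ring. apply exp_0. }
  assert (He : 0 < e) by apply exp_pos. assert (Hq' : 0 < q') by apply exp_pos.
  assert (He2 : e <= exp (l1 * (M + L / eps - a))).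
  { unfold e. destruct (Req_dec x (M + L / eps)) as [E|E]; [rewrite E; lra|].
    left; apply exp_increasing; nra. }
  assert (A1 : v <= (Abar - J1 x) * e).
  { replace v with (v * e' * e) by (rewrite Rmult_assoc, Ee; ring).
    apply Rmult_le_compat_r; lra. }
  assert (A2 : v - C * q' <= (- Bbar + J2 x) * q').
  { replace (v - C * q') with ((v * q - C) * q')
      by (rewrite Rmult_minus_distr_r, Rmult_assoc, Eq; ring).
    apply Rmult_le_compat_r; lra. }
  assert (A3 : c * (1 / l1) * e * eta <= eps).
  { rewrite <- Eeta. apply Rmult_le_compat_r; [lra|].
    apply Rmult_le_compat_l; auto. left; apply Rmult_lt_0_compat; lra. }
  assert (B1 : c * (1 / l1) * v <= c * (1 / l1) * ((Abar - J1 x) * e)).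
  { apply Rmult_le_compat_l; auto. left; apply Rmult_lt_0_compat; lra. }
  assert (B2 : c * (1 / l2) * (v - C * q') <= c * (1 / l2) * ((- Bbar + J2 x) * q')).
  { apply Rmult_le_compat_l; auto. left; apply Rmult_lt_0_compat; lra. }
  replace (c * (1 / l1 * (Abar - eta - J1 x) * e + 1 / l2 * (- Bbar + J2 x) * q'))
    with (c * (1 / l1) * ((Abar - J1 x) * e) - c * (1 / l1) * e * eta
          + c * (1 / l2) * ((- Bbar + J2 x) * q')) by ring.
  assert (X : 3 * eps = c * (1 / l1 + 1 / l2) * v - l) by (unfold eps; field; lra).
  replace (c * (1 / l1 + 1 / l2) * v) with (c * (1 / l1) * v + c * (1 / l2) * v) in X by ring.
  replace (c * (1 / l2) * (v - C * q')) with (c * (1 / l2) * v - c * (1 / l2) * C * q')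
    in B2 by ring.
  lra.
Qed.

Lemma profile_left_start l1 l2 c a f J1 J2 Abar Bbar
  (H : kernel l1 l2 c a f J1 J2 Abar Bbar) K k v m0 :
  0 < k -> (forall x, x <= m0 -> f x <= - v) -> k < c * (1 / l1 + 1 / l2) * v ->
  exists B m eps, - Bbar < B /\ m <= a /\ 0 < eps /\
    forall x, m - K / eps <= x <= m -> profile l1 l2 c a J1 J2 Abar B x <= - k - eps.
Proof.
  intros Hk Hv Hkv.
  destruct (profile_right_start _ _ _ _ _ _ _ _ _ (kernel_reflect _ _ _ _ _ _ _ _ _ H)
              K k v (- m0)) as (A & M & eps & HA & HM & Heps & HMx); auto.
  { intros x Hx. specialize (Hv (- x) ltac:(lra)). lra. }
  { rewrite (Rplus_comm (1 / l2)). auto. }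
  exists (- A), (- M), eps. split; [lra|split; [lra|split; auto]]. intros x Hx.
  specialize (HMx (- x) ltac:(lra)).
  replace A with (- - A) in HMx by ring. rewrite profile_reflect in HMx. lra.
Qed.

Section Profile.

Context (l1 l2 c a : R) (f J1 J2 : R -> R) (Abar Bbar : R).
Context (H : kernel l1 l2 c a f J1 J2 Abar Bbar).

Notation G := (profile l1 l2 c a J1 J2).

Definition slope_scale (x : R) : R := exp ((l1 + l2) * (x - a)).
Definition slope (A B x : R) : R := (A - J1 x) * slope_scale x - (B + J2 x).
(** The derivative of [slope] with respect to [slope_scale] away from [a]: dS/dx = (l1 + l2) E (P -
    e^{-l1 (x-a)} f) and dE/dx = (l1 + l2) E. *)
Definition slope_gradient (A x : R) : R := A - J1 x - exp (- l1 * (x - a)) * f x.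

Lemma J_plus_continuous (J : R -> R) (A s x : R) :
  (forall y, continuous J y) -> continuous (fun y => A + s * J y) x.
Proof.
  intros HJ. apply (continuous_plus (fun _ => A) (fun y => s * J y)).
  - apply continuous_const.
  - apply (continuous_scal_r s J x). auto.
Qed.

Lemma profile_slope_continuous (A B x : R) :
  continuous (fun y => c * ((A - J1 y) * exp (l1 * (y - a))
                            - (B + J2 y) * exp (- l2 * (y - a)))) x.
Proof.
  apply (continuous_scal_r c (fun y => (A - J1 y) * exp (l1 * (y - a))
                            - (B + J2 y) * exp (- l2 * (y - a)))).
  apply (continuous_minus (fun y => (A - J1 y) * exp (l1 * (y - a)))
           (fun y => (B + J2 y) * exp (- l2 * (y - a)))).
  - apply (continuous_mult (fun y => A - J1 y) (fun y => exp (l1 * (y - a)))).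
    + apply continuous_ext with (fun y => A + -1 * J1 y); [intros; real_eq; ring|].
      apply J_plus_continuous. apply H.
    + apply exp_affine_continuous.
  - apply (continuous_mult (fun y => B + J2 y) (fun y => exp (- l2 * (y - a)))).
    + apply continuous_ext with (fun y => B + 1 * J2 y); [intros; real_eq; ring|].
      apply J_plus_continuous. apply H.
    + apply exp_affine_continuous.
Qed.

Lemma profile_continuous (A B x : R) : continuous (G A B) x.
Proof.
  apply (continuous_scal_r c (fun y => 1 / l1 * (A - J1 y) * exp (l1 * (y - a))
       + 1 / l2 * (B + J2 y) * exp (- l2 * (y - a)))).
  apply (continuous_plus (fun y => 1 / l1 * (A - J1 y) * exp (l1 * (y - a)))
           (fun y => 1 / l2 * (B + J2 y) * exp (- l2 * (y - a)))).
  - apply (continuous_mult (fun y => 1 / l1 * (A - J1 y)) (fun y => exp (l1 * (y - a)))).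
    + apply continuous_ext with (fun y => 1 / l1 * A + - (1 / l1) * J1 y);
        [intros; real_eq; ring|].
      apply J_plus_continuous. apply H.
    + apply exp_affine_continuous.
  - apply (continuous_mult (fun y => 1 / l2 * (B + J2 y)) (fun y => exp (- l2 * (y - a)))).
    + apply continuous_ext with (fun y => 1 / l2 * B + 1 / l2 * J2 y);
        [intros; real_eq; ring|].
      apply J_plus_continuous. apply H.
    + apply exp_affine_continuous.
Qed.

(* The terms with [f] cancel, so the jump of [f] at [a] does not affect [G]. *)
Lemma profile_derive (A B x : R) :
  is_derive (G A B) x (c * exp (- l2 * (x - a)) * slope A B x).
Proof.
  replace (c * exp (- l2 * (x - a)) * slope A B x)
    with (c * ((A - J1 x) * exp (l1 * (x - a)) - (B + J2 x) * exp (- l2 * (x - a)))).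
  2:{ unfold slope, slope_scale.
      replace ((l1 + l2) * (x - a)) with (l1 * (x - a) + l2 * (x - a)) by ring.
      rewrite exp_plus.
      assert (E : exp (- l2 * (x - a)) * exp (l2 * (x - a)) = 1).
      { rewrite <- exp_plus.
        replace (- l2 * (x - a) + l2 * (x - a)) with 0 by ring. apply exp_0. }
      replace (c * exp (- l2 * (x - a)) *
        ((A - J1 x) * (exp (l1 * (x - a)) * exp (l2 * (x - a))) - (B + J2 x)))
        with (c * ((A - J1 x) * exp (l1 * (x - a))
                   * (exp (- l2 * (x - a)) * exp (l2 * (x - a)))
                   - (B + J2 x) * exp (- l2 * (x - a)))) by ring.
      rewrite E. ring. }
  assert (Hoff : forall y, y <> a -> is_derive (G A B) y
    (c * ((A - J1 y) * exp (l1 * (y - a)) - (B + J2 y) * exp (- l2 * (y - a))))).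
  { intros y Hy. destruct H.
    assert (D1 := kernel_J1_derive0 y Hy). assert (D2 := kernel_J2_derive0 y Hy).
    unfold profile. auto_derive.
    - split; [eexists; exact D1 | split; [eexists; exact D2 | exact I]].
    - assert (E1 := is_derive_unique _ _ _ D1). assert (E2 := is_derive_unique _ _ _ D2).
      change (Derive (fun y => J1 y) y) with (Derive J1 y).
      change (Derive (fun y => J2 y) y) with (Derive J2 y).
      rewrite E1, E2.
      replace (y + - a) with (y - a) by ring.
      replace (exp (- l1 * (y - a))) with (/ exp (l1 * (y - a)))
        by (rewrite <- exp_Ropp; f_equal; ring).
      replace (exp (- l2 * (y - a))) with (/ exp (l2 * (y - a)))
        by (rewrite <- exp_Ropp; f_equal; ring).
      field. pose proof (exp_pos (l1 * (y - a))). pose proof (exp_pos (l2 * (y - a))).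
      repeat split; lra. }
  destruct (Req_dec x a) as [->|Hx]; [|now apply Hoff].
  apply (is_derive_removable (G A B) (fun y => c * ((A - J1 y) * exp (l1 * (y - a))
    - (B + J2 y) * exp (- l2 * (y - a)))) a); auto.
  - intros; apply profile_continuous.
  - apply profile_slope_continuous.
Qed.

Lemma slope_scale_lt (x y : R) : x < y -> slope_scale x < slope_scale y.
Proof.
  intros Hxy. destruct H. unfold slope_scale. apply exp_increasing.
  apply Rmult_lt_compat_l; lra.
Qed.

(* [slope] is concave as a function of [slope_scale], with [slope_gradient] a
   supergradient. *)
Lemma slope_supergradient (A B x y : R) :
  slope A B y <= slope A B x + (slope_scale y - slope_scale x) * slope_gradient A x.
Proof.
  assert (X1 := kernel_J1_le _ _ _ _ _ _ _ _ _ H x y).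
  assert (X2 := kernel_J2_le _ _ _ _ _ _ _ _ _ H x y).
  unfold slope, slope_gradient.
  assert (Ex : exp (- l1 * (x - a)) * slope_scale x = exp (l2 * (x - a))).
  { unfold slope_scale. rewrite <- exp_plus. f_equal. ring. }
  assert (Ey : exp (- l1 * (y - a)) * slope_scale y = exp (l2 * (y - a))).
  { unfold slope_scale. rewrite <- exp_plus. f_equal. ring. }
  rewrite <- Ex, <- Ey in X2.
  assert (Hy : 0 < slope_scale y) by apply exp_pos.
  apply (Rmult_le_compat_r (slope_scale y)) in X1; [|lra].
  nra.
Qed.

Lemma slope_concave (A B x y z : R) : x < y -> y < z ->
  slope A B x * (slope_scale z - slope_scale y)
  + slope A B z * (slope_scale y - slope_scale x)
  <= slope A B y * (slope_scale z - slope_scale x).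
Proof.
  intros Hxy Hyz.
  assert (X1 := slope_supergradient A B y x).
  assert (X2 := slope_supergradient A B y z).
  assert (S1 := slope_scale_lt x y Hxy). assert (S2 := slope_scale_lt y z Hyz).
  apply (Rmult_le_compat_r (slope_scale z - slope_scale y)) in X1; [|lra].
  apply (Rmult_le_compat_r (slope_scale y - slope_scale x)) in X2; [|lra].
  nra.
Qed.

Definition slope_signs (A B x1 x2 : R) : Prop :=
  (forall x, x < x1 -> slope A B x < 0) /\
  (forall x, x1 < x < x2 -> 0 < slope A B x) /\
  (forall x, x2 < x -> slope A B x < 0).

Lemma slope_signs_intro (A B x1 z x2 : R) :
  x1 < z < x2 -> slope A B x1 = 0 -> slope A B x2 = 0 -> 0 < slope A B z ->
  slope_signs A B x1 x2.
Proof.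
  intros Hz E1 E2 Pz. split; [|split].
  - intros x Hx. assert (X := slope_concave A B x x1 z Hx ltac:(lra)).
    assert (S1 := slope_scale_lt x x1 Hx).
    assert (S2 := slope_scale_lt x1 z ltac:(lra)). rewrite E1 in X. nra.
  - intros x Hx. destruct (Rtotal_order x z) as [Hxz|[->|Hxz]]; auto.
    + assert (X := slope_concave A B x1 x z ltac:(lra) Hxz).
      assert (S1 := slope_scale_lt x1 x ltac:(lra)).
      assert (S2 := slope_scale_lt x z Hxz). rewrite E1 in X. nra.
    + assert (X := slope_concave A B z x x2 Hxz ltac:(lra)).
      assert (S1 := slope_scale_lt x x2 ltac:(lra)).
      assert (S2 := slope_scale_lt z x Hxz). rewrite E2 in X. nra.
  - intros x Hx. assert (X := slope_concave A B z x2 x ltac:(lra) Hx).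
    assert (S1 := slope_scale_lt x2 x Hx).
    assert (S2 := slope_scale_lt z x2 ltac:(lra)). rewrite E2 in X. nra.
Qed.

Lemma profile_MVT (A B x y : R) : x < y ->
  exists z w, x < z < y /\ 0 < w /\ G A B y - G A B x = w * slope A B z.
Proof.
  intros Hxy.
  destruct (MVT_cor2 (G A B) (fun t => c * exp (- l2 * (t - a)) * slope A B t) x y Hxy)
    as [z [Ez Hz]].
  { intros t _. apply is_derive_Reals, profile_derive. }
  exists z, (c * exp (- l2 * (z - a)) * (y - x)). split; [auto|split].
  - destruct H. pose proof (exp_pos (- l2 * (z - a))).
    repeat apply Rmult_lt_0_compat; lra.
  - rewrite Ez. ring.
Qed.

Lemma profile_increasing (A B x y : R) : x < y ->
  (forall z, x < z < y -> 0 < slope A B z) -> G A B x < G A B y.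
Proof.
  intros Hxy Hs. destruct (profile_MVT A B x y Hxy) as (z & w & Hz & Hw & E).
  specialize (Hs z Hz). nra.
Qed.

Lemma profile_decreasing (A B x y : R) : x < y ->
  (forall z, x < z < y -> slope A B z < 0) -> G A B y < G A B x.
Proof.
  intros Hxy Hs. destruct (profile_MVT A B x y Hxy) as (z & w & Hz & Hw & E).
  specialize (Hs z Hz). nra.
Qed.

Lemma slope_signs_mono (A B x1 x2 : R) : slope_signs A B x1 x2 ->
  (forall x y, x < y -> y <= x1 -> G A B y < G A B x) /\
  (forall x y, x1 <= x -> x < y -> y <= x2 -> G A B x < G A B y) /\
  (forall x y, x2 <= x -> x < y -> G A B y < G A B x).
Proof.
  intros (S1 & S2 & S3). split; [|split].
  - intros x y Hxy Hy. apply profile_decreasing; auto. intros z Hz. apply S1; lra.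
  - intros x y Hx Hxy Hy. apply profile_increasing; auto. intros z Hz. apply S2; lra.
  - intros x y Hx Hxy. apply profile_decreasing; auto. intros z Hz. apply S3; lra.
Qed.

Lemma slope_zero_of_derive_zero (A B x : R) :
  c * exp (- l2 * (x - a)) * slope A B x = 0 -> slope A B x = 0.
Proof.
  intros E. pose proof (exp_pos (- l2 * (x - a))). destruct H.
  assert (0 < c * exp (- l2 * (x - a))) by (apply Rmult_lt_0_compat; lra). nra.
Qed.

(** The extrema are zeros of [slope]; the positive value needed between them comes from the mean
    value theorem on [[D, U]], over which the profile rises. *)
Lemma slope_signs_of_extrema (A B x1 D U x2 : R) :
  local_min (G A B) x1 -> local_max (G A B) x2 -> x1 < D -> D < U -> U < x2 ->
  G A B D < G A B U ->
  slope A B x1 = 0 /\ slope A B x2 = 0 /\ slope_signs A B x1 x2.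
Proof.
  intros M1 M2 H1 H2 H3 Hlt.
  assert (E1 : slope A B x1 = 0)
    by apply slope_zero_of_derive_zero, (local_min_derive _ _ _ M1), profile_derive.
  assert (E2 : slope A B x2 = 0)
    by apply slope_zero_of_derive_zero, (local_max_derive _ _ _ M2), profile_derive.
  split; [auto|split; auto].
  destruct (profile_MVT A B D U H2) as (z & w & Hz & Hw & E).
  apply (slope_signs_intro A B x1 z x2); auto; [lra | nra].
Qed.

Lemma profile_at_slope_zero (A B x : R) : slope A B x = 0 ->
  G A B x = c * (1 / l1 + 1 / l2) * ((A - J1 x) * exp (l1 * (x - a))).
Proof.
  unfold slope, slope_scale, profile. intros E.
  assert (E' : (B + J2 x) * exp (- l2 * (x - a)) = (A - J1 x) * exp (l1 * (x - a))).
  { replace (B + J2 x) with ((A - J1 x) * exp ((l1 + l2) * (x - a))) by lra.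
    rewrite Rmult_assoc, <- exp_plus. do 2 f_equal. ring. }
  rewrite (Rmult_assoc (1 / l2)), E'. ring.
Qed.

(** At a zero of [slope] the two exponential terms balance, so the profile has the sign of
    [A - J1 x]; a nonnegative supergradient gives [A - J1 x >= exp (- l1 * (x - a)) * f x], which is
    nonnegative to the right of [a]. *)
Lemma profile_nonneg_of_slope_gradient (A B x : R) :
  slope A B x = 0 -> a <= x -> 0 <= slope_gradient A x -> 0 <= G A B x.
Proof.
  intros E Hx Hg. rewrite (profile_at_slope_zero A B x E).
  destruct H. unfold slope_gradient in Hg.
  assert (0 <= f x) by (rewrite <- kernel_f_a0; auto).
  pose proof (exp_pos (- l1 * (x - a))). pose proof (exp_pos (l1 * (x - a))).
  assert (0 < 1 / l1) by (apply Rdiv_lt_0_compat; lra).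
  assert (0 < 1 / l2) by (apply Rdiv_lt_0_compat; lra).
  apply Rmult_le_pos; [apply Rmult_le_pos; lra|].
  apply Rmult_le_pos; nra.
Qed.

Lemma profile_nonpos_of_slope_gradient (A B x : R) :
  slope A B x = 0 -> x <= a -> slope_gradient A x <= 0 -> G A B x <= 0.
Proof.
  intros E Hx Hg. rewrite (profile_at_slope_zero A B x E).
  destruct H. unfold slope_gradient in Hg.
  assert (f x <= 0) by (rewrite <- kernel_f_a0; auto).
  pose proof (exp_pos (- l1 * (x - a))). pose proof (exp_pos (l1 * (x - a))).
  assert (0 < 1 / l1) by (apply Rdiv_lt_0_compat; lra).
  assert (0 < 1 / l2) by (apply Rdiv_lt_0_compat; lra).
  assert (0 < c * (1 / l1 + 1 / l2)) by (apply Rmult_lt_0_compat; lra).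
  assert (A - J1 x <= 0) by nra.
  assert ((A - J1 x) * exp (l1 * (x - a)) <= 0) by nra. nra.
Qed.

Lemma negative_minimum_left (A B x1 z : R) :
  slope A B x1 = 0 -> x1 < z -> 0 < slope A B z -> G A B x1 < 0 -> x1 < a.
Proof.
  intros E Hz Pz Hneg. apply Rnot_le_lt. intros Ha.
  assert (X := slope_supergradient A B x1 z).
  assert (S1 := slope_scale_lt x1 z Hz).
  assert (0 <= slope_gradient A x1) by nra.
  pose proof (profile_nonneg_of_slope_gradient A B x1 E Ha). lra.
Qed.

Lemma positive_maximum_right (A B x2 z : R) :
  slope A B x2 = 0 -> z < x2 -> 0 < slope A B z -> 0 < G A B x2 -> a < x2.
Proof.
  intros E Hz Pz Hpos. apply Rnot_le_lt. intros Ha.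
  assert (X := slope_supergradient A B x2 z).
  assert (S1 := slope_scale_lt z x2 Hz).
  assert (slope_gradient A x2 <= 0) by nra.
  pose proof (profile_nonpos_of_slope_gradient A B x2 E Ha). lra.
Qed.

(** * Dependence of the profile on its coefficients *)

Lemma profile_sub (A B A' B' x : R) :
  G A B x - G A' B' x = c * (1 / l1) * (A - A') * exp (l1 * (x - a))
                        + c * (1 / l2) * (B - B') * exp (- l2 * (x - a)).
Proof. unfold profile. ring. Qed.

Lemma profile_coefficients_pos : 0 < c * (1 / l1) /\ 0 < c * (1 / l2).
Proof.
  destruct H. split; apply Rmult_lt_0_compat; auto; apply Rdiv_lt_0_compat; lra.
Qed.

Lemma profile_le (A B A' B' x : R) : A' <= A -> B' <= B -> G A' B' x <= G A B x.
Proof.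
  intros HA HB. pose proof (profile_sub A B A' B' x).
  destruct profile_coefficients_pos as [C1 C2].
  pose proof (exp_pos (l1 * (x - a))). pose proof (exp_pos (- l2 * (x - a))).
  assert (0 <= c * (1 / l1) * (A - A') * exp (l1 * (x - a)))
    by (apply Rmult_le_pos; [apply Rmult_le_pos|]; lra).
  assert (0 <= c * (1 / l2) * (B - B') * exp (- l2 * (x - a)))
    by (apply Rmult_le_pos; [apply Rmult_le_pos|]; lra).
  lra.
Qed.

Lemma profile_lt (A B A' B' x : R) :
  A' <= A -> B' <= B -> (A, B) <> (A', B') -> G A' B' x < G A B x.
Proof.
  intros HA HB Hne. pose proof (profile_sub A B A' B' x).
  destruct profile_coefficients_pos as [C1 C2].
  assert (P1 : 0 < c * (1 / l1) * exp (l1 * (x - a)))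
    by (apply Rmult_lt_0_compat; auto; apply exp_pos).
  assert (P2 : 0 < c * (1 / l2) * exp (- l2 * (x - a)))
    by (apply Rmult_lt_0_compat; auto; apply exp_pos).
  assert (A' < A \/ B' < B).
  { destruct HA as [|EA]; auto. destruct HB as [|EB]; auto.
    exfalso. apply Hne. congruence. }
  nra.
Qed.

Lemma profile_sub_increasing (A B A' B' x y : R) :
  A' <= A -> B <= B' -> (A, B) <> (A', B') -> x < y ->
  G A B x - G A' B' x < G A B y - G A' B' y.
Proof.
  intros HA HB Hne Hxy. rewrite !profile_sub.
  destruct profile_coefficients_pos as [C1 C2]. destruct H.
  assert (P1 : exp (l1 * (x - a)) < exp (l1 * (y - a)))
    by (apply exp_increasing, Rmult_lt_compat_l; lra).
  assert (P2 : exp (- l2 * (y - a)) < exp (- l2 * (x - a)))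
    by (apply exp_increasing; nra).
  assert (Hstrict : A' < A \/ B < B').
  { destruct HA as [|EA]; auto. destruct HB as [|EB]; auto.
    exfalso. apply Hne. congruence. }
  assert (Q1 : 0 <= c * (1 / l1) * (A - A')) by (apply Rmult_le_pos; lra).
  assert (Q2 : 0 <= c * (1 / l2) * (B' - B)) by (apply Rmult_le_pos; lra).
  assert (Q3 : 0 < c * (1 / l1) * (A - A') \/ 0 < c * (1 / l2) * (B' - B))
    by (destruct Hstrict; [left|right]; apply Rmult_lt_0_compat; lra).
  nra.
Qed.

(** * Wells, humps and the band conditions *)

Context (K L k l : R) (HK : 0 < K) (HL : 0 < L) (Hk : 0 < k) (Hl : 0 < l).

Definition below (A B x : R) : R := G A B x + k.
Definition above (A B x : R) : R := l - G A B x.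

Lemma below_continuous (A B x : R) : continuous (below A B) x.
Proof.
  apply (continuous_plus (G A B) (fun _ => k)).
  - apply profile_continuous.
  - apply continuous_const.
Qed.

Lemma above_continuous (A B x : R) : continuous (above A B) x.
Proof.
  apply (continuous_minus (fun _ => l) (G A B)).
  - apply continuous_const.
  - apply profile_continuous.
Qed.

Lemma RInt_above (A B U u : R) :
  RInt (above A B) U u = - RInt (fun x => G A B x - l) U u.
Proof.
  assert (X := RInt_opp (V := R_CompleteNormedModule) (fun x => G A B x - l) U u).
  unfold opp in X; simpl in X. rewrite <- X.
  - apply RInt_ext. intros x _. unfold above. real_eq. ring.
  - apply continuous_ex_RInt. intros z.
    apply (continuous_minus (G A B) (fun _ => l)).
    + apply profile_continuous.
    + apply continuous_const.
Qed.

Notation band A B := (band_conditions K L k l a (G A B)).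

Lemma band_slope (A B d D U u x1 x2 : R) : band A B d D U u x1 x2 ->
  slope A B x1 = 0 /\ slope A B x2 = 0 /\ slope_signs A B x1 x2.
Proof.
  intros ((_ & M1) & (_ & M2) & (O1 & O2 & O3 & O4 & O5) & _ & _ & _ & E2 & E3 & _).
  apply (slope_signs_of_extrema A B x1 D U x2); auto; lra.
Qed.

(** The maximality clause needs [d' < a]: an interval starting there cannot lie on the falling
    branch beyond [x2], nor reach [x2], where the profile exceeds [l]. *)
Lemma band_below_well (A B d D U u x1 x2 : R) : band A B d D U u x1 x2 ->
  well K (below A B) d D /\
  forall d' D', d' < a -> d' <= D' -> (forall x, d' <= x <= D' -> G A B x <= - k) ->
    d <= d' /\ D' <= D.
Proof.
  intros Hb. destruct (band_slope _ _ _ _ _ _ _ _ Hb) as (_ & _ & HS).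
  destruct (slope_signs_mono _ _ _ _ HS) as (S1 & S2 & S3).
  destruct Hb as ((X1 & _) & (X2 & _) & (O1 & O2 & O3 & O4 & O5) & I1 & I2 & E1 & E2 & E3 & E4).
  assert (Hx2 : l < G A B x2) by (rewrite <- E3; apply S2; lra).
  assert (Hx1 : G A B x1 < - k) by (rewrite <- E1; apply S1; lra).
  split; [split; [lra|split]|].
  - intros x Hx. unfold below.
    destruct (Rle_lt_dec x x1) as [Hxx|Hxx].
    + destruct (Req_dec d x) as [<-|Hd]; [lra|].
      assert (G A B x < G A B d) by (apply S1; lra). lra.
    + destruct (Req_dec x D) as [->|HD]; [lra|].
      assert (G A B x < G A B D) by (apply S2; lra). lra.
  - unfold below. lra.
  - intros d' D' Hd HdD Hle.
    assert (HD' : D' < x2).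
    { apply Rnot_le_lt. intros HD. specialize (Hle x2 ltac:(lra)). lra. }
    split; apply Rnot_lt_le; intros Hlt.
    + assert (G A B d < G A B d') by (apply S1; lra). specialize (Hle d' ltac:(lra)). lra.
    + assert (G A B D < G A B D') by (apply S2; lra). specialize (Hle D' ltac:(lra)). lra.
Qed.

Lemma band_above_well (A B d D U u x1 x2 : R) : band A B d D U u x1 x2 ->
  well L (above A B) U u /\
  forall U' u', a < u' -> U' <= u' -> (forall x, U' <= x <= u' -> l <= G A B x) ->
    U <= U' /\ u' <= u.
Proof.
  intros Hb. destruct (band_slope _ _ _ _ _ _ _ _ Hb) as (_ & _ & HS).
  destruct (slope_signs_mono _ _ _ _ HS) as (S1 & S2 & S3).
  destruct Hb as ((X1 & _) & (X2 & _) & (O1 & O2 & O3 & O4 & O5) & I1 & I2 & E1 & E2 & E3 & E4).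
  assert (Hx2 : l < G A B x2) by (rewrite <- E3; apply S2; lra).
  assert (Hx1 : G A B x1 < - k) by (rewrite <- E1; apply S1; lra).
  split; [split; [lra|split]|].
  - intros x Hx. unfold above.
    destruct (Rle_lt_dec x2 x) as [Hxx|Hxx].
    + destruct (Req_dec x u) as [->|Hd]; [lra|].
      assert (G A B u < G A B x) by (apply S3; lra). lra.
    + destruct (Req_dec U x) as [<-|HD]; [lra|].
      assert (G A B U < G A B x) by (apply S2; lra). lra.
  - rewrite RInt_above. lra.
  - intros U' u' Hu HUu Hle.
    assert (HU' : x1 < U').
    { apply Rnot_le_lt. intros HD. specialize (Hle x1 ltac:(lra)). lra. }
    split; apply Rnot_lt_le; intros Hlt.
    + assert (G A B U' < G A B U) by (apply S2; lra). specialize (Hle U' ltac:(lra)). lra.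
    + assert (G A B u' < G A B u) by (apply S3; lra). specialize (Hle u' ltac:(lra)). lra.
Qed.

(** * Uniqueness of the coefficients and of the thresholds *)

(** If the first profile is lower up to [D'], then [[d', D']] lies in its maximal well [[d, D]], and
    its area there is strictly more negative, although both equal [- K]. Equality at [D'] is allowed
    because the difference of two profiles may vanish exactly there. *)
Lemma band_below_compare A B d D U u x1 x2 A' B' d' D' U' u' x1' x2' :
  band A B d D U u x1 x2 -> band A' B' d' D' U' u' x1' x2' ->
  (forall x, x < D' -> G A B x < G A' B' x) -> G A B D' <= G A' B' D' -> False.
Proof.
  intros Hb Hb' Hlt Hle.
  destruct (band_below_well _ _ _ _ _ _ _ _ Hb) as ((W1 & W2 & W3) & Hmax).
  destruct (band_below_well _ _ _ _ _ _ _ _ Hb') as ((W1' & W2' & W3') & _).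
  destruct Hb as ((X1 & _) & (X2 & _) & (O1 & O2 & O3 & O4 & O5) & I1 & _).
  destruct Hb' as ((X1' & _) & (X2' & _) & (O1' & O2' & O3' & O4' & O5') & I1' & _).
  destruct (Hmax d' D') as [H1 H2]; try lra.
  { intros x Hx. specialize (W2' x Hx). unfold below in W2'.
    destruct (Req_dec x D') as [->|Hx']; [lra|]. specialize (Hlt x ltac:(lra)). lra. }
  assert (X : RInt (below A B) d D < RInt (below A' B') d' D').
  { apply RInt_shrink_lt; auto; try lra; try (intros; apply below_continuous).
    intros x Hx. unfold below. specialize (Hlt x ltac:(lra)). lra. }
  unfold below in X. lra.
Qed.

Lemma band_above_compare A B d D U u x1 x2 A' B' d' D' U' u' x1' x2' :
  band A B d D U u x1 x2 -> band A' B' d' D' U' u' x1' x2' ->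
  (forall x, U' <= x -> G A' B' x < G A B x) -> False.
Proof.
  intros Hb Hb' Hlt.
  destruct (band_above_well _ _ _ _ _ _ _ _ Hb) as ((W1 & W2 & W3) & Hmax).
  destruct (band_above_well _ _ _ _ _ _ _ _ Hb') as ((W1' & W2' & W3') & _).
  destruct Hb as ((X1 & _) & (X2 & _) & (O1 & O2 & O3 & O4 & O5) & _ & I1 & _).
  destruct Hb' as ((X1' & _) & (X2' & _) & (O1' & O2' & O3' & O4' & O5') & _ & I1' & _).
  destruct (Hmax U' u') as [H1 H2]; try lra.
  { intros x Hx. specialize (W2' x Hx). unfold above in W2'.
    specialize (Hlt x ltac:(lra)). lra. }
  assert (X : RInt (above A B) U u < RInt (above A' B') U' u').
  { apply RInt_shrink_lt; auto; try lra; try (intros; apply above_continuous).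
    intros x Hx. unfold above. specialize (Hlt x ltac:(lra)). lra. }
  rewrite !RInt_above in X. lra.
Qed.

Lemma band_coefficients_unique A B d D U u x1 x2 A' B' d' D' U' u' x1' x2' :
  band A B d D U u x1 x2 -> band A' B' d' D' U' u' x1' x2' -> (A, B) = (A', B').
Proof.
  assert (Hsame : forall A B d D U u x1 x2 A' B' d' D' U' u' x1' x2',
    band A B d D U u x1 x2 -> band A' B' d' D' U' u' x1' x2' ->
    A' <= A -> B' <= B -> (A, B) <> (A', B') -> False).
  { clear A B d D U u x1 x2 A' B' d' D' U' u' x1' x2'.
    intros * Hb Hb' HA HB Hne.
    assert (Hlt := fun x => profile_lt A B A' B' x HA HB Hne).
    apply (band_below_compare _ _ _ _ _ _ _ _ _ _ _ _ _ _ _ _ Hb' Hb); auto.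
    left; auto. }
  assert (Hcross : forall A B d D U u x1 x2 A' B' d' D' U' u' x1' x2',
    band A B d D U u x1 x2 -> band A' B' d' D' U' u' x1' x2' ->
    A' <= A -> B <= B' -> (A, B) <> (A', B') -> False).
  { clear Hsame. clear A B d D U u x1 x2 A' B' d' D' U' u' x1' x2'.
    intros * Hb Hb' HA HB Hne.
    assert (Hlt := fun x y => profile_sub_increasing A B A' B' x y HA HB Hne).
    (* [D'] separates the well from the hump: an increasing difference is negative on the whole well
       if it is nonpositive at [D'], and otherwise positive on the whole hump. *)
    destruct (Rle_lt_dec (G A B D' - G A' B' D') 0) as [Hz|Hz].
    - apply (band_below_compare _ _ _ _ _ _ _ _ _ _ _ _ _ _ _ _ Hb Hb'); [|lra].
      intros x Hx. specialize (Hlt _ _ Hx). lra.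
    - apply (band_above_compare _ _ _ _ _ _ _ _ _ _ _ _ _ _ _ _ Hb Hb').
      intros x Hx. destruct Hb' as (_ & _ & (_ & _ & O & _) & _).
      specialize (Hlt D' x ltac:(lra)). lra. }
  intros Hb Hb'.
  destruct (Req_dec A A') as [EA|NA]; [destruct (Req_dec B B') as [EB|NB]|].
  { congruence. }
  all: exfalso; assert (Hne : (A, B) <> (A', B')) by congruence;
    assert (Hne' : (A', B') <> (A, B)) by congruence;
    destruct (Rle_lt_dec A' A); destruct (Rle_lt_dec B' B);
    first [ apply (Hsame _ _ _ _ _ _ _ _ _ _ _ _ _ _ _ _ Hb Hb'); auto; lra
          | apply (Hsame _ _ _ _ _ _ _ _ _ _ _ _ _ _ _ _ Hb' Hb); auto; lra
          | apply (Hcross _ _ _ _ _ _ _ _ _ _ _ _ _ _ _ _ Hb Hb'); auto; lra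
          | apply (Hcross _ _ _ _ _ _ _ _ _ _ _ _ _ _ _ _ Hb' Hb); auto; lra ].
Qed.

Lemma band_points_unique A B d D U u x1 x2 d' D' U' u' x1' x2' :
  band A B d D U u x1 x2 -> band A B d' D' U' u' x1' x2' ->
  d = d' /\ D = D' /\ U = U' /\ u = u'.
Proof.
  intros Hb Hb'.
  destruct (band_below_well _ _ _ _ _ _ _ _ Hb) as ((W1 & W2 & _) & Hm).
  destruct (band_below_well _ _ _ _ _ _ _ _ Hb') as ((W1' & W2' & _) & Hm').
  destruct (band_above_well _ _ _ _ _ _ _ _ Hb) as ((V1 & V2 & _) & Hn).
  destruct (band_above_well _ _ _ _ _ _ _ _ Hb') as ((V1' & V2' & _) & Hn').
  destruct Hb as ((X1 & _) & (X2 & _) & (O1 & O2 & O3 & O4 & O5) & _).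
  destruct Hb' as ((X1' & _) & (X2' & _) & (O1' & O2' & O3' & O4' & O5') & _).
  unfold below, above in *.
  destruct (Hm d' D') as [? ?]; try lra.
  { intros x Hx; specialize (W2' x Hx); lra. }
  destruct (Hm' d D) as [? ?]; try lra.
  { intros x Hx; specialize (W2 x Hx); lra. }
  destruct (Hn U' u') as [? ?]; try lra.
  { intros x Hx; specialize (V2' x Hx); lra. }
  destruct (Hn' U u) as [? ?]; try lra.
  { intros x Hx; specialize (V2 x Hx); lra. }
Qed.

(** * Existence through admissible pairs *)

(** The bounds on [A] and [B] fix the tails of the profile; [d <= a] and [a <= u] then keep the well
    out of the right tail and the hump out of the left one, where any area is available. *)
Definition admissible (A B : R) : Prop :=
  A < Abar /\ - Bbar < B /\
  (exists d D, d <= a /\ well K (below A B) d D) /\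
  (exists U u, a <= u /\ well L (above A B) U u).

Lemma wells_disjoint (A B d D U u : R) :
  d <= a -> a <= u -> well K (below A B) d D -> well L (above A B) U u -> D < U.
Proof.
  intros Hd Hu (W1 & W2 & _) (V1 & V2 & _). apply Rnot_le_lt. intros HU.
  set (p := Rmax d U).
  assert (P1 : d <= p) by apply Rmax_l. assert (P2 : U <= p) by apply Rmax_r.
  assert (P3 : p <= D) by (apply Rmax_lub; lra).
  assert (P4 : p <= u) by (apply Rmax_lub; lra).
  specialize (W2 p ltac:(lra)). specialize (V2 p ltac:(lra)).
  unfold below, above in *. lra.
Qed.

(** The relaxed intervals are widened until the profile takes the exact levels at their ends. A
    nonzero area forces values strictly beyond the level, so the extrema over the widened intervals
    are interior and hence local. *)
Lemma admissible_band (A B d0 D0 U0 u0 : R) :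
  A < Abar -> - Bbar < B -> d0 <= a -> a <= u0 ->
  well K (below A B) d0 D0 -> well L (above A B) U0 u0 ->
  exists d D U u x1 x2,
    (x1 < a /\ local_min (G A B) x1) /\ (a < x2 /\ local_max (G A B) x2) /\
    (d < x1 /\ x1 < D /\ D < U /\ U < x2 /\ x2 < u) /\
    (G A B d = - k /\ G A B D = - k /\ G A B U = l /\ G A B u = l) /\
    (d <= d0 /\ D0 <= D /\ U <= U0 /\ u0 <= u) /\ slope_signs A B x1 x2.
Proof.
  intros HA HB Hd0 Hu0 HW HV.
  assert (HDU := wells_disjoint _ _ _ _ _ _ Hd0 Hu0 HW HV).
  assert (Cb := below_continuous A B). assert (Ca := above_continuous A B).
  assert (Cg := profile_continuous A B).
  destruct (well_negative_point _ _ _ _ HK Cb HW) as (p & Hp & Np).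
  destruct (well_negative_point _ _ _ _ HL Ca HV) as (q & Hq & Nq).
  destruct HW as (W1 & W2 & _). destruct HV as (V1 & V2 & _).
  destruct (profile_left_tail _ _ _ _ _ _ _ _ _ H A B (- k) HB) as (m & Hm & Hmx).
  destruct (profile_right_tail _ _ _ _ _ _ _ _ _ H A B l HA) as (M & HM & HMx).
  assert (Gd0 := W2 d0 ltac:(lra)). assert (GD0 := W2 D0 ltac:(lra)).
  assert (GU0 := V2 U0 ltac:(lra)). assert (Gu0 := V2 u0 ltac:(lra)).
  unfold below, above in *.
  (* The tails bring the profile back across each level on the outer sides; between [D0] and [U0] it
     crosses both levels. *)
  destruct (continuous_IVT (G A B) (Rmin m d0) d0 (- k)) as (d & Hd & Ed); auto.
  { apply Rmin_r. }
  { right. specialize (Hmx (Rmin m d0) (Rmin_l _ _)). lra. }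
  destruct (continuous_IVT (G A B) D0 U0 (- k)) as (D & HD & ED); auto; [lra|lra|].
  destruct (continuous_IVT (G A B) D U0 l) as (U & HU & EU); auto; [lra|lra|].
  destruct (continuous_IVT (G A B) u0 (Rmax M u0) l) as (u & Hu & Eu); auto.
  { apply Rmax_r. }
  { right. specialize (HMx (Rmax M u0) (Rmax_l _ _)). lra. }
  destruct (continuity_ab_min (G A B) d D) as (x1 & M1 & B1); [lra| |].
  { intros; now apply continuous_continuity_pt. }
  destruct (continuity_ab_maj (G A B) U u) as (x2 & M2 & B2); [lra| |].
  { intros; now apply continuous_continuity_pt. }
  assert (N1 : G A B x1 < - k) by (specialize (M1 p ltac:(lra)); lra).
  assert (N2 : l < G A B x2) by (specialize (M2 q ltac:(lra)); lra).
  assert (x1 <> d) by (intros ->; lra). assert (x1 <> D) by (intros ->; lra).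
  assert (x2 <> U) by (intros ->; lra). assert (x2 <> u) by (intros ->; lra).
  assert (HDU' : D < U) by (destruct (proj1 HU) as [| ->]; lra).
  assert (Lmin : local_min (G A B) x1).
  { apply (locally_open_interval d x1 D); [lra|]. intros t Ht. apply M1; lra. }
  assert (Lmax : local_max (G A B) x2).
  { apply (locally_open_interval U x2 u); [lra|]. intros t Ht. apply M2; lra. }
  destruct (slope_signs_of_extrema A B x1 D U x2) as (E1 & E2 & HS); auto; try lra.
  assert (Pz : 0 < slope A B ((x1 + x2) / 2)) by (apply HS; lra).
  assert (x1 < a) by (apply (negative_minimum_left A B x1 ((x1 + x2) / 2)); auto; lra).
  assert (a < x2) by (apply (positive_maximum_right A B x2 ((x1 + x2) / 2)); auto; lra).
  exists d, D, U, u, x1, x2. repeat split; auto; try lra; apply HS.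
Qed.

(** Confines the search: with [A <= A0] and [B0 <= B], both coefficients lie in [[B0, A0]]. *)
Lemma admissible_le (A B : R) : admissible A B -> B <= A.
Proof.
  intros (HA & HB & (d & D & Hd & HW) & (U & u & Hu & HV)).
  destruct (admissible_band A B d D U u HA HB Hd Hu HW HV)
    as (d' & D' & U' & u' & x1 & x2 & (X1 & _) & (X2 & _) & _ & _ & _ & _ & S2 & _).
  specialize (S2 a ltac:(lra)). unfold slope, slope_scale in S2. destruct H.
  rewrite kernel_J1_a0, kernel_J2_a0 in S2.
  replace ((l1 + l2) * (a - a)) with 0 in S2 by ring. rewrite exp_0 in S2. lra.
Qed.

(** The well is inherited from (A', B'), since lowering A' to A lowers the profile; the hump from
    (A, B), since raising B to B' lifts it. *)
Lemma admissible_combine (A B A' B' : R) :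
  admissible A B -> admissible A' B' -> A <= A' -> B <= B' -> admissible A B'.
Proof.
  intros (HA & HB & (d & D & Hd & HW) & (U & u & Hu & HV))
    (HA' & HB' & (d' & D' & Hd' & HW') & (U' & u' & Hu' & HV')) LA LB.
  split; [auto|split; [auto|split]].
  - exists d', D'. split; auto.
    apply (well_le K (below A' B')); auto; try (intros; apply below_continuous).
    intros x _. unfold below. pose proof (profile_le A' B' A B' x LA (Rle_refl _)). lra.
  - exists U, u. split; auto.
    apply (well_le L (above A B)); auto; try (intros; apply above_continuous).
    intros x _. unfold above. pose proof (profile_le A B' A B x (Rle_refl _) LB). lra.
Qed.

(** [A] is chosen for the hump with the other coefficient at [- Bbar], and [B] for the well with the
    other at [Abar]. The choices are independent: raising [- Bbar] to [B] helps the hump, lowering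
    [Abar] to [A] helps the well. *)
Lemma admissible_exists v v' M0 m0 :
  (forall x, M0 <= x -> v <= f x) -> l < c * (1 / l1 + 1 / l2) * v ->
  (forall x, x <= m0 -> f x <= - v') -> k < c * (1 / l1 + 1 / l2) * v' ->
  exists A B, admissible A B.
Proof.
  intros Hv Hlv Hv' Hkv.
  destruct (profile_right_start _ _ _ _ _ _ _ _ _ H L l v M0 Hl Hv Hlv)
    as (A & M & eps & HA & HM & Heps & HMx).
  destruct (profile_left_start _ _ _ _ _ _ _ _ _ H K k v' m0 Hk Hv' Hkv)
    as (B & m & eps' & HB & Hm & Heps' & Hmx).
  assert (Iconst : forall (e x y : R), RInt (fun _ => e) x y = (y - x) * e).
  { intros. now rewrite RInt_const. }
  assert (0 < L / eps) by (apply Rdiv_lt_0_compat; lra).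
  assert (0 < K / eps') by (apply Rdiv_lt_0_compat; lra).
  exists A, B. split; [auto|split; [auto|split]].
  - exists (m - K / eps'), m. split; [lra|].
    apply (well_le K (fun _ => - eps')); try (intros; apply below_continuous).
    + intros; apply continuous_const.
    + intros x Hx. unfold below. specialize (Hmx x Hx).
      pose proof (profile_le Abar B A B x ltac:(lra) (Rle_refl _)). lra.
    + split; [lra|split; [intros; lra|]]. rewrite Iconst. right. field. lra.
  - exists M, (M + L / eps). split; [lra|].
    apply (well_le L (fun _ => - eps)); try (intros; apply above_continuous).
    + intros; apply continuous_const.
    + intros x Hx. unfold above. specialize (HMx x Hx).
      pose proof (profile_le A B A (- Bbar) x (Rle_refl _) ltac:(lra)). lra.
    + split; [lra|split; [intros; lra|]]. rewrite Iconst. right. field. lra.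
Qed.

(* Lowering [A] deepens the well below [- k] and raising [B] enlarges the hump
   above [l], so the two areas are traded off at the corner [(inf A, sup B)]. *)
Lemma admissible_corner (A0 B0 : R) : admissible A0 B0 ->
  exists A B, A <= A0 /\ B0 <= B /\ admissible A B /\
    forall A' B', admissible A' B' -> A' <= A -> B <= B' -> A' = A /\ B' = B.
Proof.
  intros H0. assert (HA0 := proj1 H0). assert (HB0 := proj1 (proj2 H0)).
  assert (HBA0 := admissible_le _ _ H0).
  set (EB := fun B => exists A, admissible A B /\ A <= A0 /\ B0 <= B).
  set (EA := fun nA => exists B, admissible (- nA) B /\ - nA <= A0 /\ B0 <= B).
  destruct (completeness EB) as (Bs & HBub & HBlub).
  { exists A0. intros B (A & HAB & LA & LB). pose proof (admissible_le _ _ HAB). lra. }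
  { exists B0, A0. repeat split; try apply H0; lra. }
  destruct (completeness EA) as (nAs & HAub & HAlub).
  { exists (- B0). intros nA (B & HAB & LA & LB). pose proof (admissible_le _ _ HAB). lra. }
  { exists (- A0), B0. rewrite Ropp_involutive. repeat split; try apply H0; lra. }
  set (As := - nAs).
  assert (HBs : B0 <= Bs).
  { apply HBub. exists A0. repeat split; try apply H0; lra. }
  assert (HAs : As <= A0).
  { assert (- A0 <= nAs); [|unfold As; lra].
    apply HAub. exists B0. rewrite Ropp_involutive. repeat split; try apply H0; lra. }
  assert (Hnear : forall eps, 0 < eps -> exists A B, admissible A B /\
    As <= A <= A0 /\ A < As + eps /\ B0 <= B <= Bs /\ Bs - eps < B).
  { intros eps Heps.
    assert (X1 : exists B, EB B /\ Bs - eps < B).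
    { apply NNPP. intros Hn. assert (Bs <= Bs - eps); [|lra].
      apply HBlub. intros B HB. apply Rnot_lt_le. intros Hlt. apply Hn. eauto. }
    assert (X2 : exists nA, EA nA /\ nAs - eps < nA).
    { apply NNPP. intros Hn. assert (nAs <= nAs - eps); [|lra].
      apply HAlub. intros B HB. apply Rnot_lt_le. intros Hlt. apply Hn. eauto. }
    destruct X1 as (B & HB & HBe). destruct X2 as (nA & HnA & HnAe).
    assert (LB' := HBub B HB). assert (LA' := HAub nA HnA).
    destruct HB as (A' & HAB' & LA & LB). destruct HnA as (B' & HAB'' & LA'' & LB'').
    assert (LB3 : B' <= Bs).
    { apply HBub. exists (- nA). auto. }
    assert (LA3 : - A' <= nAs).
    { apply HAub. exists B. rewrite Ropp_involutive. auto. }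
    destruct (Rle_lt_dec A' (- nA)) as [C1|C1].
    - exists A', B. unfold As. split; [auto|lra].
    - destruct (Rle_lt_dec B B') as [C2|C2].
      + exists (- nA), B'. unfold As. split; [auto|lra].
      + exists (- nA), B. split; [|unfold As; lra].
        apply (admissible_combine (- nA) B' A' B); auto; lra. }
  destruct (profile_left_tail _ _ _ _ _ _ _ _ _ H B0 B0 (- k) HB0) as (m & Hm & Hmx).
  destruct (profile_right_tail _ _ _ _ _ _ _ _ _ H A0 A0 l HA0) as (M & HM & HMx).
  assert (Hbox : forall A B, admissible A B -> A <= A0 -> B0 <= B ->
    exists d D U u, (m <= d <= a /\ m <= D <= M /\ well K (below A B) d D) /\
      (m <= U <= M /\ a <= u <= M /\ well L (above A B) U u)).
  { intros A B HAB LA LB. assert (HBA := admissible_le _ _ HAB).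
    destruct HAB as (_ & _ & (d & D & Hd & HW) & (U & u & Hu & HV)).
    assert (HDU := wells_disjoint _ _ _ _ _ _ Hd Hu HW HV).
    exists d, D, U, u.
    assert (m <= d).
    { apply Rnot_lt_le. intros Hlt. specialize (Hmx d ltac:(lra)).
      pose proof (profile_le A B B0 B0 d ltac:(lra) ltac:(lra)).
      destruct HW as (W1 & W2 & _). specialize (W2 d ltac:(lra)). unfold below in W2. lra. }
    assert (u <= M).
    { apply Rnot_lt_le. intros Hlt. specialize (HMx u ltac:(lra)).
      pose proof (profile_le A0 A0 A B u ltac:(lra) ltac:(lra)).
      destruct HV as (V1 & V2 & _). specialize (V2 u ltac:(lra)). unfold above in V2. lra. }
    destruct HW as (W1 & HW). destruct HV as (V1 & HV).
    repeat split; auto; try lra; try apply HW; apply HV. }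
  destruct profile_coefficients_pos as [C1 C2].
  assert (Hadm : admissible As Bs).
  { split; [lra|split; [lra|split]].
    - destruct (well_limit K m a m M (below As Bs)) as (d & D & Hd & HD & HW); auto.
      { intros; apply below_continuous. }
      { intros eps Heps.
        set (w := c * (1 / l2) * exp (- l2 * (m - a))).
        assert (Hw : 0 < w) by (apply Rmult_lt_0_compat; auto; apply exp_pos).
        destruct (Hnear (eps / w)) as (A & B & HAB & LA & LA' & LB & LB').
        { apply Rdiv_lt_0_compat; lra. }
        destruct (Hbox A B HAB) as (d & D & U & u & (B1 & B2 & B3) & _); try lra.
        exists (below A B), d, D. repeat split; try apply B3; try lra.
        { intros; apply below_continuous. }
        intros x Hx. unfold below.
        pose proof (profile_le A Bs As Bs x ltac:(lra) ltac:(lra)).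
        pose proof (profile_sub A Bs A B x).
        assert (exp (- l2 * (x - a)) <= exp (- l2 * (m - a))).
        { destruct H. destruct (Req_dec x m) as [->|Hne]; [lra|].
          left; apply exp_increasing; nra. }
        assert (c * (1 / l2) * (Bs - B) * exp (- l2 * (x - a)) <= eps).
        { apply Rle_trans with (c * (1 / l2) * (Bs - B) * exp (- l2 * (m - a))).
          - apply Rmult_le_compat_l; auto. apply Rmult_le_pos; lra.
          - replace (c * (1 / l2) * (Bs - B) * exp (- l2 * (m - a))) with ((Bs - B) * w)
              by (unfold w; ring).
            apply Rle_trans with (eps / w * w).
            + apply Rmult_le_compat_r; lra.
            + right; field; lra. }
        replace (A - A) with 0 in * by ring. lra. }
      exists d, D. split; [lra|auto].
    - destruct (well_limit L m M a M (above As Bs)) as (U & u & HU & Hu & HV); auto.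
      { intros; apply above_continuous. }
      { intros eps Heps.
        set (w := c * (1 / l1) * exp (l1 * (M - a))).
        assert (Hw : 0 < w) by (apply Rmult_lt_0_compat; auto; apply exp_pos).
        destruct (Hnear (eps / w)) as (A & B & HAB & LA & LA' & LB & LB').
        { apply Rdiv_lt_0_compat; lra. }
        destruct (Hbox A B HAB) as (d & D & U & u & _ & (B1 & B2 & B3)); try lra.
        exists (above A B), U, u. repeat split; try apply B3; try lra.
        { intros; apply above_continuous. }
        intros x Hx. unfold above.
        pose proof (profile_le As Bs As B x ltac:(lra) ltac:(lra)).
        pose proof (profile_sub A B As B x).
        assert (exp (l1 * (x - a)) <= exp (l1 * (M - a))).
        { destruct H. destruct (Req_dec x M) as [->|Hne]; [lra|].
          left; apply exp_increasing; nra. }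
        assert (c * (1 / l1) * (A - As) * exp (l1 * (x - a)) <= eps).
        { apply Rle_trans with (c * (1 / l1) * (A - As) * exp (l1 * (M - a))).
          - apply Rmult_le_compat_l; auto. apply Rmult_le_pos; lra.
          - replace (c * (1 / l1) * (A - As) * exp (l1 * (M - a))) with ((A - As) * w)
              by (unfold w; ring).
            apply Rle_trans with (eps / w * w).
            + apply Rmult_le_compat_r; lra.
            + right; field; lra. }
        replace (B - B) with 0 in * by ring. lra. }
      exists U, u. split; [lra|auto]. }
  exists As, Bs. split; [auto|split; [auto|split; [auto|]]].
  intros A' B' HAB LA LB.
  assert (B' <= Bs) by (apply HBub; exists A'; repeat split; try apply HAB; lra).
  assert (- A' <= nAs).
  { apply HAub. exists B'. rewrite Ropp_involutive. repeat split; try apply HAB; lra. }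
  unfold As in *. lra.
Qed.

Lemma band_exists (A0 B0 : R) : admissible A0 B0 ->
  exists A B d D U u x1 x2, band A B d D U u x1 x2.
Proof.
  intros H0.
  destruct (admissible_corner A0 B0 H0) as (A & B & _ & _ & HAB & Hmax).
  destruct HAB as (HA & HB & (d0 & D0 & Hd0 & HW) & (U0 & u0 & Hu0 & HV)).
  destruct (admissible_band A B d0 D0 U0 u0 HA HB Hd0 Hu0 HW HV)
    as (d & D & U & u & x1 & x2 & X1 & X2 & (O1 & O2 & O3 & O4 & O5)
        & (E1 & E2 & E3 & E4) & (L1 & L2 & L3 & L4) & HS).
  destruct (slope_signs_mono _ _ _ _ HS) as (S1 & S2 & S3).
  destruct profile_coefficients_pos as [C1 C2].
  assert (Nb : forall x, d < x < D -> below A B x < 0).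
  { intros x Hx. unfold below. destruct (Rle_lt_dec x x1).
    - assert (G A B x < G A B d) by (apply S1; lra). lra.
    - assert (G A B x < G A B D) by (apply S2; lra). lra. }
  assert (Na : forall x, U < x < u -> above A B x < 0).
  { intros x Hx. unfold above. destruct (Rle_lt_dec x2 x).
    - assert (G A B u < G A B x) by (apply S3; lra). lra.
    - assert (G A B U < G A B x) by (apply S2; lra). lra. }
  assert (Ib : RInt (below A B) d D <= - K).
  { apply Rle_trans with (RInt (below A B) d0 D0); [|apply HW].
    destruct HW as (W1 & _).
    apply RInt_shrink; auto; try (intros; apply below_continuous).
    intros x Hx. destruct (Req_dec x d) as [->|]; [unfold below; lra|].
    destruct (Req_dec x D) as [->|]; [unfold below; lra|]. left; apply Nb; lra. }
  assert (Ia : RInt (above A B) U u <= - L).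
  { apply Rle_trans with (RInt (above A B) U0 u0); [|apply HV].
    destruct HV as (V1 & _).
    apply RInt_shrink; auto; try (intros; apply above_continuous).
    intros x Hx. destruct (Req_dec x U) as [->|]; [unfold above; lra|].
    destruct (Req_dec x u) as [->|]; [unfold above; lra|]. left; apply Na; lra. }
  assert (Ib' : - K <= RInt (below A B) d D).
  { apply Rnot_lt_le. intros Hlt.
    destruct (well_robust K (a - d) (below A B) d D)
      as (eps & d' & D' & Heps & Hd' & HD' & Hrob); auto; try lra.
    { intros; apply below_continuous. }
    set (w := c * (1 / l2) * exp (- l2 * (d - a))).
    assert (Hw : 0 < w) by (apply Rmult_lt_0_compat; auto; apply exp_pos).
    assert (He : 0 < eps / w) by (apply Rdiv_lt_0_compat; lra).
    destruct (Hmax A (B + eps / w)) as [_ Habs]; try lra.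
    split; [auto|split; [lra|split]].
    - exists d', D'. split; [lra|]. apply Hrob; [intros; apply below_continuous|].
      intros x Hx. unfold below.
      pose proof (profile_sub A (B + eps / w) A B x) as X.
      assert (exp (- l2 * (x - a)) <= exp (- l2 * (d - a))).
      { destruct H. left; apply exp_increasing; nra. }
      assert (c * (1 / l2) * (B + eps / w - B) * exp (- l2 * (x - a)) <= eps).
      { apply Rle_trans with (c * (1 / l2) * (B + eps / w - B) * exp (- l2 * (d - a))).
        - apply Rmult_le_compat_l; auto. apply Rmult_le_pos; lra.
        - right. replace (c * (1 / l2) * (B + eps / w - B) * exp (- l2 * (d - a)))
            with (eps / w * w) by (unfold w at 2; ring). field. lra. }
      replace (A - A) with 0 in X by ring. lra.
    - exists U0, u0. split; auto.
      apply (well_le L (above A B)); auto; try (intros; apply above_continuous).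
      intros x _. unfold above.
      pose proof (profile_le A (B + eps / w) A B x (Rle_refl _) ltac:(lra)). lra. }
  assert (Ia' : - L <= RInt (above A B) U u).
  { apply Rnot_lt_le. intros Hlt.
    destruct (well_robust L (u - a) (above A B) U u)
      as (eps & U' & u' & Heps & HU' & Hu' & Hrob); auto; try lra.
    { intros; apply above_continuous. }
    set (w := c * (1 / l1) * exp (l1 * (u - a))).
    assert (Hw : 0 < w) by (apply Rmult_lt_0_compat; auto; apply exp_pos).
    assert (He : 0 < eps / w) by (apply Rdiv_lt_0_compat; lra).
    destruct (Hmax (A - eps / w) B) as [Habs _]; try lra.
    split; [lra|split; [auto|split]].
    - exists d0, D0. split; auto.
      apply (well_le K (below A B)); auto; try (intros; apply below_continuous).
      intros x _. unfold below.
      pose proof (profile_le A B (A - eps / w) B x ltac:(lra) (Rle_refl _)). lra.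
    - exists U', u'. split; [lra|]. apply Hrob; [intros; apply above_continuous|].
      intros x Hx. unfold above.
      pose proof (profile_sub A B (A - eps / w) B x) as X.
      assert (exp (l1 * (x - a)) <= exp (l1 * (u - a))).
      { destruct H. left; apply exp_increasing; nra. }
      assert (c * (1 / l1) * (A - (A - eps / w)) * exp (l1 * (x - a)) <= eps).
      { apply Rle_trans with (c * (1 / l1) * (A - (A - eps / w)) * exp (l1 * (u - a))).
        - apply Rmult_le_compat_l; auto. apply Rmult_le_pos; lra.
        - right. replace (c * (1 / l1) * (A - (A - eps / w)) * exp (l1 * (u - a)))
            with (eps / w * w) by (unfold w at 2; ring). field. lra. }
      replace (B - B) with 0 in X by ring. lra. }
  rewrite RInt_above in Ia, Ia'. unfold below in Ib, Ib'.
  exists A, B, d, D, U, u, x1, x2.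
  repeat split; try apply X1; try apply X2; auto; lra.
Qed.

End Profile.

(** * The kernel of a convex cost *)

Lemma convex_tangent (h : R -> R) (x y : R) :
  convex_fun h -> ex_derive h x -> h x + Derive h x * (y - x) <= h y.
Proof.
  intros Hc Hd. apply Rnot_lt_le. intros Hlt.
  set (r := y - x). set (gap := h x + Derive h x * r - h y).
  assert (Hgap : 0 < gap) by (unfold gap, r; lra).
  assert (Hr : r <> 0).
  { intros E. unfold gap in Hgap. rewrite E in Hgap.
    replace y with x in Hgap by (unfold r in E; lra). lra. }
  assert (Hr' : 0 < Rabs r) by now apply Rabs_pos_lt.
  assert (D : derivable_pt_lim h x (Derive h x))
    by (apply is_derive_Reals; now apply Derive_correct).
  destruct (D (gap / Rabs r)) as [del Hdel]; [now apply Rdiv_lt_0_compat|].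
  set (t := Rmin 1 (del / (2 * Rabs r))).
  assert (Ht : 0 < t <= 1).
  { split; [|apply Rmin_l]. apply Rmin_glb_lt; [lra|].
    apply Rdiv_lt_0_compat; [apply cond_pos | lra]. }
  assert (Ht2 : t * Rabs r < del).
  { apply Rle_lt_trans with (del / (2 * Rabs r) * Rabs r).
    - apply Rmult_le_compat_r; [lra | apply Rmin_r].
    - replace (del / (2 * Rabs r) * Rabs r) with (del / 2) by (field; lra).
      pose proof (cond_pos del). lra. }
  specialize (Hdel (t * r)).
  assert (Htr : t * r <> 0) by (apply Rmult_integral_contrapositive; lra).
  specialize (Hdel Htr).
  rewrite Rabs_mult, (Rabs_pos_eq t) in Hdel by lra. specialize (Hdel Ht2).
  assert (X := Hc y x t ltac:(lra)).
  replace (t * y + (1 - t) * x) with (x + t * r) in X by (unfold r; ring).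
  set (s := h (x + t * r) - h x) in *.
  assert (Hs : s <= t * (h y - h x)) by (unfold s; lra).
  assert (Y : Rabs (s - t * r * Derive h x) < gap / Rabs r * (t * Rabs r)).
  { replace (s - t * r * Derive h x) with ((s / (t * r) - Derive h x) * (t * r))
      by (field; lra).
    rewrite Rabs_mult, (Rabs_mult t), (Rabs_pos_eq t) by lra.
    apply Rmult_lt_compat_r; [nra | auto]. }
  replace (gap / Rabs r * (t * Rabs r)) with (gap * t) in Y by (field; lra).
  apply Rabs_def2 in Y. unfold gap in Y. nra.
Qed.

Lemma convex_derive_mono (h : R -> R) (x y : R) :
  convex_fun h -> ex_derive h x -> ex_derive h y -> x <= y -> Derive h x <= Derive h y.
Proof.
  intros Hc Hx Hy [Hxy | ->]; [|lra].
  assert (X := convex_tangent h x y Hc Hx). assert (Y := convex_tangent h y x Hc Hy). nra.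
Qed.

Lemma mono_right_extension (f : R -> R) (a : R) :
  (forall x y, x <= y -> f x <= f y) -> (forall x, x <> a -> continuous f x) ->
  exists fr : R -> R, (forall x, continuous fr x) /\ forall x, a < x -> fr x = f x.
Proof.
  intros Hm Hc.
  destruct (completeness (fun z => exists y, a < y /\ z = - f y)) as [w [Hw1 Hw2]].
  { exists (- f a). intros z (y & Hy & ->). specialize (Hm a y ltac:(lra)). lra. }
  { exists (- f (a + 1)), (a + 1). split; auto; lra. }
  assert (Hv : forall y, a < y -> - w <= f y).
  { intros y Hy. assert (- f y <= w) by (apply Hw1; eauto). lra. }
  exists (fun x => if Rlt_dec a x then f x else - w). split.
  2:{ intros x Hx. destruct (Rlt_dec a x); auto; lra. }
  intros x. destruct (Rtotal_order x a) as [Hx|[->|Hx]].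
  - apply continuous_ext_loc with (fun _ => - w); [|apply continuous_const].
    apply (locally_open_interval (x - 1) x a); [lra|]. intros t Ht.
    destruct (Rlt_dec a t); auto; lra.
  - intros P [e He].
    destruct (classic (exists y, a < y /\ f y < - w + e)) as [(y & Hy & Hfy)|Hn].
    + apply (locally_open_interval (a - 1) a y); [lra|]. intros t Ht. apply He.
      destruct (Rlt_dec a a) as [|_]; [lra|].
      unfold ball; simpl; unfold AbsRing_ball, abs, minus, plus, opp; simpl.
      pose proof (cond_pos e).
      destruct (Rlt_dec a t) as [Hat|_].
      * specialize (Hv t Hat). specialize (Hm t y ltac:(lra)). apply Rabs_def1; lra.
      * apply Rabs_def1; lra.
    + exfalso. assert (w <= w - e); [|pose proof (cond_pos e); lra].
      apply Hw2. intros z (y & Hy & ->). apply Rnot_lt_le. intros Hlt.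
      apply Hn. exists y. split; auto; lra.
  - apply continuous_ext_loc with f; [|apply Hc; lra].
    apply (locally_open_interval a x (x + 1)); [lra|]. intros t Ht.
    destruct (Rlt_dec a t); auto; lra.
Qed.

Lemma mono_left_extension (f : R -> R) (a : R) :
  (forall x y, x <= y -> f x <= f y) -> (forall x, x <> a -> continuous f x) ->
  exists fl : R -> R, (forall x, continuous fl x) /\ forall x, x < a -> fl x = f x.
Proof.
  intros Hm Hc.
  destruct (mono_right_extension (fun x => - f (- x)) (- a)) as (fr & Cr & Er).
  - intros x y Hxy. specialize (Hm (- y) (- x) ltac:(lra)). lra.
  - intros x Hx. apply (continuous_opp (fun x => f (- x))).
    apply (continuous_comp (fun y : R => - y) f).
    + apply (continuous_opp (fun y : R => y)), continuous_id.
    + apply Hc. lra.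
  - exists (fun x => - fr (- x)). split.
    + intros x. apply (continuous_opp (fun x => fr (- x))).
      apply (continuous_comp (fun y : R => - y) fr); auto.
      apply (continuous_opp (fun y : R => y)), continuous_id.
    + intros x Hx. rewrite Er by lra. rewrite !Ropp_involutive. auto.
Qed.

Section Weighted.

Context (a : R) (f : R -> R).
Context (Hmono : forall x y, x <= y -> f x <= f y).
Context (Hcont : forall x, x <> a -> continuous f x).

Definition weighted_integral (s x : R) : R := RInt (fun y => exp (s * (y - a)) * f y) a x.

Lemma weighted_ex_RInt (s x y : R) : ex_RInt (fun t => exp (s * (t - a)) * f t) x y.
Proof.
  assert (Ha : forall z, ex_RInt (fun t => exp (s * (t - a)) * f t) a z).
  { intros z. destruct (Rle_lt_dec a z) as [Hz|Hz].
    - destruct (mono_right_extension f a Hmono Hcont) as (g & Cg & Eg).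
      apply ex_RInt_ext with (fun t => exp (s * (t - a)) * g t).
      + intros t Ht. rewrite Rmin_left in Ht by lra. rewrite Eg; auto; lra.
      + apply continuous_ex_RInt. intros t.
        apply (continuous_mult (fun t => exp (s * (t - a))) g); auto.
        apply exp_affine_continuous.
    - destruct (mono_left_extension f a Hmono Hcont) as (g & Cg & Eg).
      apply ex_RInt_ext with (fun t => exp (s * (t - a)) * g t).
      + intros t Ht. rewrite Rmax_left in Ht by lra. rewrite Eg; auto; lra.
      + apply continuous_ex_RInt. intros t.
        apply (continuous_mult (fun t => exp (s * (t - a))) g); auto.
        apply exp_affine_continuous. }
  apply ex_RInt_Chasles with a; auto. apply ex_RInt_swap; auto.
Qed.

Lemma weighted_integral_derive (s x : R) : x <> a ->
  is_derive (weighted_integral s) x (exp (s * (x - a)) * f x).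
Proof.
  intros Hx.
  apply (is_derive_RInt (fun y => exp (s * (y - a)) * f y) (weighted_integral s) a).
  - exists (mkposreal 1 Rlt_0_1). intros y _.
    apply (RInt_correct (V := R_CompleteNormedModule)), weighted_ex_RInt.
  - apply (continuous_mult (fun t => exp (s * (t - a))) f); auto.
    apply exp_affine_continuous.
Qed.

Lemma weighted_integral_continuous (s x : R) : continuous (weighted_integral s) x.
Proof.
  apply (continuous_RInt_1 (fun y => exp (s * (y - a)) * f y) a x (weighted_integral s)).
  exists (mkposreal 1 Rlt_0_1). intros y _.
  apply (RInt_correct (V := R_CompleteNormedModule)), weighted_ex_RInt.
Qed.

Lemma weighted_integral_sub (s x y : R) :
  RInt (fun t => exp (s * (t - a)) * f t) x y = weighted_integral s y - weighted_integral s x.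
Proof.
  assert (X := RInt_Chasles (V := R_CompleteNormedModule) _ a x y
                 (weighted_ex_RInt s a x) (weighted_ex_RInt s x y)).
  unfold plus in X; simpl in X. unfold weighted_integral. lra.
Qed.

Lemma weighted_integral_ge (s x y : R) : s <> 0 ->
  f x * ((exp (s * (y - a)) - exp (s * (x - a))) / s)
  <= weighted_integral s y - weighted_integral s x.
Proof.
  intros Hs. rewrite <- weighted_integral_sub.
  assert (Hw : forall v p q, is_RInt (fun t => exp (s * (t - a)) * v) p q
    (v * ((exp (s * (q - a)) - exp (s * (p - a))) / s))).
  { intros v p q.
    replace (v * ((exp (s * (q - a)) - exp (s * (p - a))) / s))
      with (minus (exp (s * (q - a)) * v / s) (exp (s * (p - a)) * v / s))
      by (unfold minus, plus, opp; simpl; field; auto).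
    apply (is_RInt_derive (fun t => exp (s * (t - a)) * v / s)).
    - intros t _. auto_derive; auto. replace (t + - a) with (t - a) by ring. field; auto.
    - intros t _. apply (continuous_mult (fun t => exp (s * (t - a))) (fun _ => v)).
      + apply exp_affine_continuous.
      + apply continuous_const. }
  assert (E : forall v p q, RInt (fun t => exp (s * (t - a)) * v) p q
    = v * ((exp (s * (q - a)) - exp (s * (p - a))) / s)).
  { intros. apply is_RInt_unique, Hw. }
  destruct (Rle_lt_dec x y) as [Hxy|Hxy].
  - rewrite <- E. apply RInt_le; auto.
    + eexists; apply Hw.
    + apply weighted_ex_RInt.
    + intros t Ht. apply Rmult_le_compat_l; [left; apply exp_pos | apply Hmono; lra].
  - assert (X : RInt (fun t => exp (s * (t - a)) * f t) y x
                <= RInt (fun t => exp (s * (t - a)) * f x) y x).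
    { apply RInt_le; [lra | apply weighted_ex_RInt | eexists; apply Hw |].
      intros t Ht. apply Rmult_le_compat_l; [left; apply exp_pos | apply Hmono; lra]. }
    rewrite E in X. rewrite weighted_integral_sub in *.
    replace ((exp (s * (y - a)) - exp (s * (x - a))) / s)
      with (- ((exp (s * (x - a)) - exp (s * (y - a))) / s)) by (field; auto). lra.
Qed.

End Weighted.

Section Cost.

Context (mu sigma beta k l a : R) (h : R -> R).
Context (hsigma : 0 < sigma) (hbeta : 0 < beta).
Context (hh : cost_assumption mu sigma beta k l a h).

Notation l1 := (lambda1 mu sigma beta).
Notation l2 := (lambda2 mu sigma beta).

Lemma Rabs_lt_discriminant_sqrt : Rabs mu < sqrt (mu ^ 2 + 2 * beta * sigma ^ 2).
Proof.
  rewrite <- sqrt_Rsqr_abs. apply sqrt_lt_1_alt. unfold Rsqr.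
  assert (0 < sigma ^ 2) by (apply pow_lt; auto). nra.
Qed.

Lemma lambda1_pos : 0 < l1.
Proof.
  pose proof Rabs_lt_discriminant_sqrt. pose proof (Rle_abs mu).
  apply Rdiv_lt_0_compat; [lra | apply pow_lt; auto].
Qed.

Lemma lambda2_pos : 0 < l2.
Proof.
  pose proof Rabs_lt_discriminant_sqrt. pose proof (Rle_abs (- mu)).
  rewrite Rabs_Ropp in *. apply Rdiv_lt_0_compat; [lra | apply pow_lt; auto].
Qed.

Lemma lambda_prod : l1 * l2 = 2 * beta / sigma ^ 2.
Proof.
  unfold lambda1, lambda2.
  assert (Hp : 0 < sigma ^ 2) by (apply pow_lt; auto).
  assert (E : sqrt (mu ^ 2 + 2 * beta * sigma ^ 2) * sqrt (mu ^ 2 + 2 * beta * sigma ^ 2)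
              = mu ^ 2 + 2 * beta * sigma ^ 2) by (apply sqrt_sqrt; nra).
  set (r := sqrt (mu ^ 2 + 2 * beta * sigma ^ 2)) in *.
  replace ((r - mu) / sigma ^ 2 * ((r + mu) / sigma ^ 2))
    with ((r * r - mu ^ 2) / (sigma ^ 2 * sigma ^ 2)) by (field; lra).
  rewrite E. field. lra.
Qed.

(* [Derive h a] is a junk value when [h] has a kink at [a]. *)
Definition marginal_cost (x : R) : R := if Req_EM_T x a then 0 else Derive h x.

Lemma marginal_cost_off (x : R) : x <> a -> marginal_cost x = Derive h x.
Proof. intros Hx. unfold marginal_cost. destruct (Req_EM_T x a); auto; lra. Qed.

Lemma marginal_cost_at : marginal_cost a = 0.
Proof. unfold marginal_cost. destruct (Req_EM_T a a); auto; lra. Qed.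

Lemma marginal_cost_mono (x y : R) : x <= y -> marginal_cost x <= marginal_cost y.
Proof.
  intros Hxy. destruct hh.
  destruct (Req_dec x a) as [->|Hx]; destruct (Req_dec y a) as [->|Hy].
  - lra.
  - rewrite marginal_cost_at, marginal_cost_off by auto. apply cost_deriv_right; lra.
  - rewrite marginal_cost_at, marginal_cost_off by auto. apply cost_deriv_left; lra.
  - rewrite !marginal_cost_off by auto.
    apply convex_derive_mono; auto; now apply cost_C2.
Qed.

Lemma locally_neq (x : R) : x <> a -> locally x (fun y => y <> a).
Proof.
  intros Hx. destruct (Rtotal_order x a) as [H|[H|H]]; [| lra |].
  - apply (locally_open_interval (x - 1) x a); [lra|]. intros; lra.
  - apply (locally_open_interval a x (x + 1)); [lra|]. intros; lra.
Qed.

Lemma marginal_cost_continuous (x : R) : x <> a -> continuous marginal_cost x.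
Proof.
  intros Hx. apply continuous_ext_loc with (Derive h).
  - apply filter_imp with (2 := locally_neq x Hx). intros y Hy.
    now rewrite marginal_cost_off.
  - apply (ex_derive_continuous (V := R_NormedModule)). now apply (cost_C2 _ _ _ _ _ _ _ hh).
Qed.

Notation I := (weighted_integral a marginal_cost).

Lemma weighted_integral_marginal_cost (s x : R) :
  I s x = RInt (fun y => exp (s * (y - a)) * Derive h y) a x.
Proof.
  apply RInt_ext. intros t Ht. rewrite marginal_cost_off; auto. intros ->.
  unfold Rmin, Rmax in Ht. destruct (Rle_dec a x); lra.
Qed.

Lemma weighted_integral_by_parts (s p q V : R) : p <= q -> a < p \/ q < a ->
  is_RInt (fun y => exp (s * y) * Derive_n h 2 y) p q V ->
  s * (I s q - I s p)
  = exp (- s * a) * (exp (s * q) * marginal_cost q - exp (s * p) * marginal_cost p - V).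
Proof.
  intros Hpq Hside HV.
  assert (Hne : forall x, p <= x <= q -> x <> a) by (intros; lra).
  rewrite !marginal_cost_off by (apply Hne; lra).
  assert (D : is_RInt (fun y => s * exp (s * y) * Derive h y + exp (s * y) * Derive_n h 2 y)
    p q (exp (s * q) * Derive h q - exp (s * p) * Derive h p)).
  { apply (is_RInt_derive (fun y => exp (s * y) * Derive h y)).
    - intros y Hy. rewrite Rmin_left, Rmax_right in Hy by lra.
      destruct (cost_C2 _ _ _ _ _ _ _ hh y (Hne y Hy)) as (_ & Hd & _).
      auto_derive; auto. change (Derive_n h 2 y) with (Derive (fun z => Derive h z) y). ring.
    - intros y Hy. rewrite Rmin_left, Rmax_right in Hy by lra.
      destruct (cost_C2 _ _ _ _ _ _ _ hh y (Hne y Hy)) as (_ & Hd & Hc).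
      assert (Ce : continuous (fun y => exp (s * y)) y).
      { apply (ex_derive_continuous (V := R_NormedModule)). auto_derive; auto. }
      apply (continuous_plus (fun y => s * exp (s * y) * Derive h y)
               (fun y => exp (s * y) * Derive_n h 2 y)).
      + apply (continuous_mult (fun y => s * exp (s * y)) (Derive h)).
        * apply (continuous_scal_r s (fun y => exp (s * y))); auto.
        * now apply (ex_derive_continuous (V := R_NormedModule)).
      + apply (continuous_mult (fun y => exp (s * y)) (Derive_n h 2)); auto. }
  assert (D2 := is_RInt_minus _ _ _ _ _ _ D HV).
  assert (D3 := is_RInt_scal _ _ _ (exp (- s * a)) _ D2).
  assert (D4 : RInt (fun y => s * (exp (s * (y - a)) * marginal_cost y)) p q
    = exp (- s * a) * (exp (s * q) * Derive h q - exp (s * p) * Derive h p - V)).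
  { apply is_RInt_unique. eapply is_RInt_ext; [|exact D3].
    intros y Hy. rewrite Rmin_left, Rmax_right in Hy by lra.
    rewrite marginal_cost_off by (apply Hne; lra).
    replace (s * (y - a)) with (- s * a + s * y) by ring. rewrite exp_plus.
    unfold scal, minus, plus, opp; simpl; unfold mult; simpl. ring. }
  rewrite <- D4, <- (weighted_integral_sub a marginal_cost marginal_cost_mono
                       marginal_cost_continuous).
  symmetry.
  apply (RInt_scal (V := R_CompleteNormedModule)
           (fun y => exp (s * (y - a)) * marginal_cost y) p q s).
  apply weighted_ex_RInt; [apply marginal_cost_mono | apply marginal_cost_continuous].
Qed.

Lemma weighted_integral_right_bounded :
  exists C, forall x, a <= x -> l1 * I (- l1) x <= C.
Proof.
  assert (P1 := lambda1_pos).
  assert (Hm : forall x y, a <= x -> x <= y -> I (- l1) x <= I (- l1) y).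
  { intros x y Hx Hxy.
    assert (X := weighted_integral_ge a marginal_cost marginal_cost_mono
                   marginal_cost_continuous (- l1) x y ltac:(lra)).
    assert (0 <= marginal_cost x)
      by (rewrite <- marginal_cost_at; apply marginal_cost_mono; auto).
    assert (0 <= (exp (- l1 * (y - a)) - exp (- l1 * (x - a))) / - l1).
    { replace ((exp (- l1 * (y - a)) - exp (- l1 * (x - a))) / - l1)
        with ((exp (- l1 * (x - a)) - exp (- l1 * (y - a))) / l1) by (field; lra).
      apply Rmult_le_pos; [|left; apply Rinv_0_lt_compat; auto].
      destruct Hxy as [Hxy| ->]; [|lra].
      assert (exp (- l1 * (y - a)) < exp (- l1 * (x - a)))
        by (apply exp_increasing; nra). lra. }
    nra. }
  destruct (cost_integral_right _ _ _ _ _ _ _ hh) as [V HV].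
  destruct (HV (fun z => Rabs (z - V) < 1)) as [Q1 Q2 HQ1 [M HQ2] HQ].
  { exists (mkposreal 1 Rlt_0_1). intros z Hz. exact Hz. }
  destruct HQ1 as [e He].
  set (p := a + e / 2). pose proof (cond_pos e).
  assert (Hp : Q1 p).
  { apply He; [|unfold p; lra].
    unfold ball; simpl; unfold AbsRing_ball, abs, minus, plus, opp; simpl.
    unfold p. apply Rabs_def1; lra. }
  set (C := exp (- - l1 * a) * (exp (- l1 * p) * marginal_cost p + V + 1)).
  exists (l1 * I (- l1) p + C). intros x Hx.
  set (q := Rmax (M + 1) (Rmax p x)).
  assert (q1 : M + 1 <= q) by apply Rmax_l.
  assert (q2 : Rmax p x <= q) by apply Rmax_r.
  assert (q3 : p <= q) by (apply Rle_trans with (2 := q2), Rmax_l).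
  assert (q4 : x <= q) by (apply Rle_trans with (2 := q2), Rmax_r).
  destruct (HQ p q Hp) as (W & HW & HWV); [apply HQ2; lra|]. simpl in HW.
  apply Rabs_def2 in HWV.
  assert (X := weighted_integral_by_parts (- l1) p q W q3 ltac:(left; unfold p; lra) HW).
  assert (0 <= exp (- l1 * q) * marginal_cost q).
  { apply Rmult_le_pos; [left; apply exp_pos|].
    rewrite <- marginal_cost_at. apply marginal_cost_mono. unfold p in *; lra. }
  assert (Y : exp (- - l1 * a) * (exp (- l1 * p) * marginal_cost p
                - exp (- l1 * q) * marginal_cost q + W) <= C).
  { apply Rmult_le_compat_l; [left; apply exp_pos | lra]. }
  specialize (Hm x q Hx q4). nra.
Qed.

Lemma weighted_integral_left_bounded :
  exists C, forall x, x <= a -> l2 * I l2 x <= C.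
Proof.
  assert (P2 := lambda2_pos).
  assert (Hm : forall x y, y <= a -> x <= y -> I l2 y <= I l2 x).
  { intros x y Hy Hxy.
    assert (X := weighted_integral_ge a marginal_cost marginal_cost_mono
                   marginal_cost_continuous l2 y x ltac:(lra)).
    assert (marginal_cost y <= 0)
      by (rewrite <- marginal_cost_at; apply marginal_cost_mono; auto).
    assert (0 <= (exp (l2 * (y - a)) - exp (l2 * (x - a))) / l2).
    { apply Rmult_le_pos; [|left; apply Rinv_0_lt_compat; auto].
      destruct Hxy as [Hxy| ->]; [|lra].
      assert (exp (l2 * (x - a)) < exp (l2 * (y - a)))
        by (apply exp_increasing; nra). lra. }
    replace ((exp (l2 * (x - a)) - exp (l2 * (y - a))) / l2)
      with (- ((exp (l2 * (y - a)) - exp (l2 * (x - a))) / l2)) in X by (field; lra).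
    nra. }
  destruct (cost_integral_left _ _ _ _ _ _ _ hh) as [V HV].
  destruct (HV (fun z => Rabs (z - V) < 1)) as [Q1 Q2 [M HQ1] HQ2 HQ].
  { exists (mkposreal 1 Rlt_0_1). intros z Hz. exact Hz. }
  destruct HQ2 as [e He].
  set (p := a - e / 2). pose proof (cond_pos e).
  assert (Hp : Q2 p).
  { apply He; [|unfold p; lra].
    unfold ball; simpl; unfold AbsRing_ball, abs, minus, plus, opp; simpl.
    unfold p. apply Rabs_def1; lra. }
  set (C := exp (- l2 * a) * (- (exp (l2 * p) * marginal_cost p) + V + 1)).
  exists (l2 * I l2 p + C). intros x Hx.
  set (q := Rmin (M - 1) (Rmin p x)).
  assert (q1 : q <= M - 1) by apply Rmin_l.
  assert (q2 : q <= Rmin p x) by apply Rmin_r.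
  assert (q3 : q <= p) by (apply Rle_trans with (1 := q2), Rmin_l).
  assert (q4 : q <= x) by (apply Rle_trans with (1 := q2), Rmin_r).
  destruct (HQ q p) as (W & HW & HWV); [apply HQ1; lra | auto |]. simpl in HW.
  apply Rabs_def2 in HWV.
  assert (X := weighted_integral_by_parts l2 q p W q3 ltac:(right; unfold p; lra) HW).
  assert (exp (l2 * q) * marginal_cost q <= 0).
  { assert (marginal_cost q <= 0).
    { rewrite <- marginal_cost_at. apply marginal_cost_mono. unfold p in *; lra. }
    pose proof (exp_pos (l2 * q)). nra. }
  assert (Y : exp (- l2 * a) * (- (exp (l2 * p) * marginal_cost p)
                + exp (l2 * q) * marginal_cost q + W) <= C).
  { apply Rmult_le_compat_l; [left; apply exp_pos | lra]. }
  specialize (Hm q x Hx q4). nra.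
Qed.

Lemma bounded_lub (P : R -> Prop) (J : R -> R) (C : R) :
  P a -> (forall x, P x -> J x <= C) ->
  exists S, (forall x, P x -> J x <= S) /\ forall B, B < S -> exists x, P x /\ B < J x.
Proof.
  intros Ha HC.
  destruct (completeness (fun z => exists x, P x /\ z = J x)) as [S [S1 S2]].
  - exists C. intros z (x & Hx & ->). auto.
  - exists (J a), a. auto.
  - exists S. split.
    + intros x Hx. apply S1. eauto.
    + intros B HB. apply NNPP. intros Hn.
      assert (S <= B); [|lra]. apply S2. intros z (x & Hx & ->).
      apply Rnot_lt_le. intros Hlt. apply Hn. eauto.
Qed.

Lemma cost_kernel : exists Abar Bbar,
  kernel l1 l2 (2 / sigma ^ 2 * (1 / (l1 + l2))) a marginal_cost
    (fun x => l1 * I (- l1) x) (fun x => l2 * I l2 x) Abar Bbar.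
Proof.
  assert (P1 := lambda1_pos). assert (P2 := lambda2_pos).
  destruct weighted_integral_right_bounded as [C HC].
  destruct weighted_integral_left_bounded as [C' HC'].
  destruct (bounded_lub (fun x => a <= x) _ C (Rle_refl a) HC) as (Abar & A1 & A2).
  destruct (bounded_lub (fun x => x <= a) _ C' (Rle_refl a) HC') as (Bbar & B1 & B2).
  assert (Ia : forall s, I s a = 0).
  { intros s. apply (RInt_point (V := R_CompleteNormedModule)). }
  assert (Hge := weighted_integral_ge a marginal_cost marginal_cost_mono
                   marginal_cost_continuous).
  exists Abar, Bbar. split; auto.
  - assert (0 < sigma ^ 2) by (apply pow_lt; auto).
    apply Rmult_lt_0_compat; apply Rdiv_lt_0_compat; lra.
  - apply marginal_cost_mono.
  - apply marginal_cost_at.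
  - rewrite Ia; ring.
  - rewrite Ia; ring.
  - intros x y. specialize (Hge (- l1) x y ltac:(lra)).
    apply (Rmult_le_compat_l l1) in Hge; [|lra].
    replace (marginal_cost x * (exp (- l1 * (x - a)) - exp (- l1 * (y - a))))
      with (l1 * (marginal_cost x
                  * ((exp (- l1 * (y - a)) - exp (- l1 * (x - a))) / - l1)))
      by (field; lra). lra.
  - intros x y. specialize (Hge l2 x y ltac:(lra)).
    apply (Rmult_le_compat_l l2) in Hge; [|lra].
    replace (marginal_cost x * (exp (l2 * (y - a)) - exp (l2 * (x - a))))
      with (l2 * (marginal_cost x * ((exp (l2 * (y - a)) - exp (l2 * (x - a))) / l2)))
      by (field; lra). lra.
  - intros x Hx. rewrite Rmult_assoc.
    apply (is_derive_scal (I (- l1)) x l1), weighted_integral_derive; auto.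
    + apply marginal_cost_mono.
    + apply marginal_cost_continuous.
  - intros x Hx. rewrite Rmult_assoc.
    apply (is_derive_scal (I l2) x l2), weighted_integral_derive; auto.
    + apply marginal_cost_mono.
    + apply marginal_cost_continuous.
  - intros x. apply (continuous_scal_r l1 (I (- l1))), weighted_integral_continuous.
    + apply marginal_cost_mono.
    + apply marginal_cost_continuous.
  - intros x. apply (continuous_scal_r l2 (I l2)), weighted_integral_continuous.
    + apply marginal_cost_mono.
    + apply marginal_cost_continuous.
Qed.

Lemma g_fun_profile (A B : R) :
  g_fun mu sigma beta a h A B
  = profile l1 l2 (2 / sigma ^ 2 * (1 / (l1 + l2))) a
      (fun x => l1 * I (- l1) x) (fun x => l2 * I l2 x) A B.
Proof.
  apply functional_extensionality. intros x. unfold g_fun, profile.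
  now rewrite !weighted_integral_marginal_cost.
Qed.

Lemma g_scale : 2 / sigma ^ 2 * (1 / (l1 + l2)) * (1 / l1 + 1 / l2) = / beta.
Proof.
  assert (P1 := lambda1_pos). assert (P2 := lambda2_pos). assert (E := lambda_prod).
  assert (Hp : 0 < sigma ^ 2) by (apply pow_lt; auto).
  replace (2 / sigma ^ 2 * (1 / (l1 + l2)) * (1 / l1 + 1 / l2))
    with (2 / sigma ^ 2 / (l1 * l2)) by (field; repeat split; lra).
  rewrite E. field. split; lra.
Qed.

Lemma marginal_cost_right_tail :
  exists v M, l * beta < v /\ forall x, M <= x -> v <= marginal_cost x.
Proof.
  destruct (cost_lim_right _ _ _ _ _ _ _ hh) as (v & Hv & Hlt).
  assert (X : exists w, l * beta < w /\ Rbar_locally v (fun z => w <= z)).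
  { destruct v as [v| |]; simpl in Hlt; [| |easy].
    - exists ((l * beta + v) / 2). split; [lra|].
      assert (Hp : 0 < (v - l * beta) / 2) by lra.
      exists (mkposreal _ Hp). intros z Hz.
      unfold ball in Hz; simpl in Hz; unfold AbsRing_ball, abs, minus, plus, opp in Hz;
        simpl in Hz. apply Rabs_def2 in Hz. lra.
    - exists (l * beta + 1). split; [lra|]. exists (l * beta + 1). intros; lra. }
  destruct X as (w & Hw & HX). destruct (Hv _ HX) as [M HM].
  exists w, (Rmax M a + 1). split; auto. intros x Hx.
  pose proof (Rmax_l M a). pose proof (Rmax_r M a).
  rewrite marginal_cost_off by lra. apply HM. lra.
Qed.

Lemma marginal_cost_left_tail :
  exists v m, k * beta < v /\ forall x, x <= m -> marginal_cost x <= - v.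
Proof.
  destruct (cost_lim_left _ _ _ _ _ _ _ hh) as (v & Hv & Hlt).
  assert (X : exists w, k * beta < w /\ Rbar_locally v (fun z => z <= - w)).
  { destruct v as [v| |]; simpl in Hlt; [|easy|].
    - exists ((k * beta - v) / 2). split; [lra|].
      assert (Hp : 0 < (- k * beta - v) / 2) by lra.
      exists (mkposreal _ Hp). intros z Hz.
      unfold ball in Hz; simpl in Hz; unfold AbsRing_ball, abs, minus, plus, opp in Hz;
        simpl in Hz. apply Rabs_def2 in Hz. lra.
    - exists (k * beta + 1). split; [lra|]. exists (- (k * beta + 1)). intros; lra. }
  destruct X as (w & Hw & HX). destruct (Hv _ HX) as [m Hm].
  exists w, (Rmin m a - 1). split; auto. intros x Hx.
  pose proof (Rmin_l m a). pose proof (Rmin_r m a).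
  rewrite marginal_cost_off by lra. apply Hm. lra.
Qed.

End Cost.

(* Uniqueness is stated for the sextuple as a whole: iterating [exists!] over
   the six components would mean something different. *)
Theorem theorem6p1 (mu sigma beta K L k l a : R) (h : R -> R)
  (hsigma : 0 < sigma) (hbeta : 0 < beta) (hK : 0 < K) (hL : 0 < L)
  (hk : 0 < k) (hl : 0 < l)
  (hh : cost_assumption mu sigma beta k l a h) :
  (exists! t : R * R * R * R * R * R,
     let '(A, B, d, D, U, u) := t in
     exists x1 x2 : R,
       band_conditions K L k l a (g_fun mu sigma beta a h A B) d D U u x1 x2)
  /\
  (forall A B d D U u x1 x2 : R,
     band_conditions K L k l a (g_fun mu sigma beta a h A B) d D U u x1 x2 ->
     strictly_decreasing_on (fun x => x < x1) (g_fun mu sigma beta a h A B) /\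
     strictly_increasing_on (fun x => x1 < x < x2)
       (g_fun mu sigma beta a h A B) /\
     strictly_decreasing_on (fun x => x2 < x) (g_fun mu sigma beta a h A B)).
Proof.
  destruct (cost_kernel _ _ _ _ _ _ _ hsigma hbeta hh) as (Abar & Bbar & HK).
  assert (Hg := g_fun_profile mu sigma beta a h).
  assert (Escale := g_scale mu sigma beta hsigma hbeta).
  split.
  - destruct (marginal_cost_right_tail _ _ _ _ _ _ _ hh) as (v & M & Hv & HM).
    destruct (marginal_cost_left_tail _ _ _ _ _ _ _ hh) as (v' & m & Hv' & Hm).
    assert (Hdiv : forall y z, y * beta < z -> y < / beta * z).
    { intros y z Hyz. apply (Rmult_lt_reg_r beta); auto.
      replace (/ beta * z * beta) with z by (field; lra). auto. }
    destruct (admissible_exists _ _ _ _ _ _ _ _ _ HK K L k l hK hL hk hl v v' M m)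
      as (A0 & B0 & H0); auto; try (rewrite Escale; auto).
    destruct (band_exists _ _ _ _ _ _ _ _ _ HK K L k l hK hL hk hl A0 B0 H0)
      as (A & B & d & D & U & u & x1 & x2 & Hb).
    exists (A, B, d, D, U, u). split.
    + exists x1, x2. now rewrite Hg.
    + intros [[[[[A' B'] d'] D'] U'] u'] (y1 & y2 & Hb'). rewrite Hg in Hb'.
      assert (E := band_coefficients_unique _ _ _ _ _ _ _ _ _ HK K L k l hk hl
                     _ _ _ _ _ _ _ _ _ _ _ _ _ _ _ _ Hb Hb').
      injection E as <- <-.
      destruct (band_points_unique _ _ _ _ _ _ _ _ _ HK K L k l hk hl
                  _ _ _ _ _ _ _ _ _ _ _ _ _ _ Hb Hb') as (<- & <- & <- & <-).
      reflexivity.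
  - intros A B d D U u x1 x2 Hb. rewrite Hg in *.
    destruct (band_slope _ _ _ _ _ _ _ _ _ HK K L k l hk hl _ _ _ _ _ _ _ _ Hb)
      as (_ & _ & HS).
    destruct (slope_signs_mono _ _ _ _ _ _ _ _ _ HK _ _ _ _ HS) as (S1 & S2 & S3).
    split; [|split]; intros x y Hx Hy Hxy.
    + apply S1; lra.
    + apply S2; lra.
    + apply S3; lra.
Qed.
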